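(* Suppose that $f$ has the MLR property, i.e. $f(x_1-\eta_1)f(x_2-\eta_2)\ge f(x_1-\eta_2)f(x_2-\eta_1)$ whenever $-\infty<x_1<x_2<\infty$ and $-\infty<\eta_1<\eta_2<\infty$, and let $c_0$ be such that $\int_{-\infty}^{c_0}f(z)\,dz=\frac12$. Let $\delta_\phi(\mathbf X)=X_{(2)}-\phi(U)$ be a location equivariant estimator of $\theta_{(2)}$ such that (i) $\phi(t)$ is increasing in $t$; (ii) $\lim_{t\to\infty}\phi(t)=b_0$, where $b_0$ is the solution of the equation $2\int_{-\infty}^{b_0}f(x)F(x)\,dx=\frac12$; (iii) $\phi$ satisfies $\displaystyle \int_{-\infty}^{\phi(t)}\int_0^t f(z-u)f(z)\,du\,dz\ge\frac12\int_{-\infty}^{\infty}\int_0^t f(z-u)f(z)\,du\,dz$ for all $t\in[0,\infty)$. Then the estimator $\delta_\phi(\mathbf X)=X_{(2)}-\phi(U)$ improves upon (dominates) the estimator $\delta_{b_0}(\mathbf X)=X_{(2)}-b_0$ with respect to the absolute error loss $|a-\theta_{(2)}|$.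
   Context: Setting: $f$ is a Lebesgue probability density on $\mathbb{R}$ with distribution function $F(x)=\int_{-\infty}^x f(t)\,dt$; $X_1,X_2$ are independent and $X_i$ has density $x\mapsto f(x-\theta_i)$, where $\boldsymbol\theta=(\theta_1,\theta_2)\in\mathbb{R}^2$ is unknown. Write $\theta_{(2)}=\max\{\theta_1,\theta_2\}$, $X_{(1)}=\min\{X_1,X_2\}$, $X_{(2)}=\max\{X_1,X_2\}$, $U=X_{(2)}-X_{(1)}$, $\mathbf X=(X_1,X_2)$, $\phi:[0,\infty)\to\mathbb{R}$. The risk of an estimator $\delta$ is $R(\boldsymbol\theta,\delta)=E_{\boldsymbol\theta}|\delta(\mathbf X)-\theta_{(2)}|$. ''Improves upon'' has its usual decision-theoretic meaning: $\delta$ improves upon $\delta'$ if $R(\boldsymbol\theta,\delta)\le R(\boldsymbol\theta,\delta')$ for all $\boldsymbol\theta\in\mathbb{R}^2$, with strict inequality for some $\boldsymbol\theta$. Standing assumption: all integrals involving the loss are finite and differentiation under the integral sign is permissible.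
   Formalization: ''Increasing'' is read as nondecreasing, and it is additionally assumed that φ(t) ≠ b_0 for some t > 0; otherwise (e.g. φ ≡ b_0, which satisfies (i)–(iii)) the two estimators coincide almost surely and strict improvement fails. *)

(* Defs.v *)
From HB Require Import structures.
From mathcomp Require Import all_boot all_order all_algebra.
From mathcomp Require Import all_classical all_reals all_analysis.
Import Order.TTheory GRing.Theory Num.Theory.
Import numFieldNormedType.Exports.

Set Implicit Arguments.
Unset Strict Implicit.
Unset Printing Implicit Defensive.

Local Open Scope classical_set_scope.
Local Open Scope ring_scope.

Definition prob_density (R : realType) (f : R -> R) : Prop :=
  [/\ measurable_fun setT f,
      forall x, 0 <= f x &
      (\int[lebesgue_measure]_x (f x)%:E = 1)%E].

Definition dist_fun (R : realType) (f : R -> R) (x : R) : R :=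
  \int[lebesgue_measure]_(t in `]-oo, x]) f t.

Definition MLR (R : realType) (f : R -> R) : Prop :=
  forall x1 x2 eta1 eta2 : R, x1 < x2 -> eta1 < eta2 ->
    f (x1 - eta2) * f (x2 - eta1) <= f (x1 - eta1) * f (x2 - eta2).

Definition has_density d (T : measurableType d) (R : realType)
    (P : probability T R) (X : {mfun T >-> R}) (g : R -> R) : Prop :=
  forall A : set R, measurable A ->
    distribution P X A = (\int[lebesgue_measure]_(x in A) (g x)%:E)%E.

Definition independent_RVs d (T : measurableType d) (R : realType)
    (P : probability T R) (X Y : {mfun T >-> R}) : Prop :=
  forall A B : set R, measurable A -> measurable B ->
    P (X @^-1` A `&` Y @^-1` B) = (P (X @^-1` A) * P (Y @^-1` B))%E.

(* The parameter is theta = (theta.1, theta.2); the sample space and the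
   observations X1, X2 are fixed while the probability P theta varies. *)
Definition location_model d (T : measurableType d) (R : realType) (f : R -> R)
    (P : R * R -> probability T R) (X1 X2 : {mfun T >-> R}) : Prop :=
  forall theta : R * R,
    [/\ independent_RVs (P theta) X1 X2,
        has_density (P theta) X1 (fun x => f (x - theta.1)) &
        has_density (P theta) X2 (fun x => f (x - theta.2))].

Definition risk d (T : measurableType d) (R : realType)
    (P : R * R -> probability T R) (X1 X2 : {mfun T >-> R})
    (delta : R -> R -> R) (theta : R * R) : \bar R :=
  'E_(P theta)
    [fun w => `|delta (X1 w) (X2 w) - Num.max theta.1 theta.2|%R]%E.

Definition improves_upon d (T : measurableType d) (R : realType)
    (P : R * R -> probability T R) (X1 X2 : {mfun T >-> R})
    (delta delta' : R -> R -> R) : Prop :=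
  (forall theta, risk P X1 X2 delta theta <= risk P X1 X2 delta' theta)%E /\
  (exists theta, risk P X1 X2 delta theta < risk P X1 X2 delta' theta)%E.

(* phi is only ever evaluated on nonnegative reals. *)
Definition equivariant_estimator (R : realType) (phi : R -> R)
    (x1 x2 : R) : R :=
  Num.max x1 x2 - phi (Num.max x1 x2 - Num.min x1 x2).

(* Main.v *)
(** Write Z = X_(2) - theta_(2) and lam = |theta_1 - theta_2|.  Since phi
    increases to b0, integrating d/dc |Z - c| from c = phi(U) to b0 turns the
    difference of the two risks into
      \int_(c < b0) (P(phi(U) < c, Z <= c) - P(phi(U) < c, c < Z)) dc,
    so it suffices that, for each window W = [set s >= 0 | phi s < c], Z is at
    least as likely to be <= c as > c on the event U \in W.  For lam = 0 this is
    the hypothesis on phi, in the limit t -> sup W.  The law of Z on this event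
    has density f(z + lam) G(z) + f(z) G(z + lam), with G(z) the integral of
    f(z - u) over u in W.  By the MLR property, inherited by G, its ratio to
    the density for lam = 0 is nonincreasing in z, which carries the inequality
    from lam = 0 to every lam.

    For strictness, take lam > 0 small.  Equality would make f(z + lam) / f(z)
    and G(z + lam) / G(z) constant on the support of f.  If the support is
    unbounded to the left, then f is lam-periodic almost everywhere; if it has
    a left endpoint a, then G(z) -> 0 as z decreases to a while G(z + lam) does
    not. *)

Require Import Defs.
From HB Require Import structures.
From mathcomp Require Import all_boot all_order all_algebra.
From mathcomp Require Import all_classical all_reals all_analysis.
From mathcomp Require Import measurable_realfun ring lra.
Import Order.TTheory GRing.Theory Num.Theory.
Import numFieldNormedType.Exports.

Set Implicit Arguments.
Unset Strict Implicit.
Unset Printing Implicit Defensive.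

Local Open Scope classical_set_scope.
Local Open Scope ring_scope.

(** * Invariance of Lebesgue measure and its integrals under translation and reflection *)

Section translation.
Context {R : realType}.
Notation mu := (@lebesgue_measure R).

(** Lebesgue measure is determined by the lengths of half-open intervals, which a translation
    preserves. *)
Lemma lebesgue_measure_translate (a : R) (A : set R) : measurable A ->
  pushforward mu (+%R^~ a : R -> measurableTypeR R) A = mu A.
Proof.
move=> mA; apply/esym/lebesgue_measure_unique => //=.
  exact: measurable_funD.
move=> _ _ [[b c] _ <-]; rewrite /pushforward.
rewrite (_ : _ @^-1` _ = `]b - a, c - a]%classic).
  rewrite !lebesgue_measure_itv/= !lte_fin ltrD2r.
  by case: ifP => // _; rewrite -!EFinD; congr EFin; ring.
by apply/seteqP; split => x/=; rewrite !in_itv/= ltrBlDr lerBrDr.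
Qed.

Lemma ge0_integral_translate (a : R) (h : R -> \bar R) :
  measurable_fun [set: R] h -> (forall x, 0 <= h x)%E ->
  (\int[mu]_x h (x + a)%R = \int[mu]_x h x)%E.
Proof.
move=> mh h0.
have mt : measurable_fun setT (+%R^~ a : R -> measurableTypeR R).
  exact: measurable_funD.
transitivity (\int[pushforward mu (+%R^~ a : R -> measurableTypeR R)]_x h x)%E.
  by rewrite ge0_integral_pushforward.
by apply: eq_measure_integral => A mA _; exact: lebesgue_measure_translate.
Qed.

Lemma ge0_integral_reflect (a : R) (h : R -> \bar R) :
  measurable_fun [set: R] h -> (forall x, 0 <= h x)%E ->
  (\int[mu]_x h (a - x)%R = \int[mu]_x h x)%E.
Proof.
move=> mh h0; under eq_integral do rewrite addrC.
rewrite -(ge0_integral_translate a mh h0).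
transitivity (\int[pushforward mu (-%R : _ -> measurableTypeR R)]_x h (x + a)%R)%E.
  rewrite ge0_integral_pushforward//.
  by apply: measurableT_comp => //; exact: measurable_funD.
by apply: eq_measure_integral => A mA _; exact: lebesgue_measureN.
Qed.

End translation.

(** * Measures given by a density *)

Section density_measure.
Context d (T : measurableType d) (R : realType).
Variables (mu : {measure set T -> \bar R}) (g : T -> \bar R).
Hypotheses (mg : measurable_fun [set: T] g) (g0 : forall x, (0 <= g x)%E).

(* The proofs are arguments so that the measure structure can be inferred. *)
Definition density_measure of measurable_fun [set: T] g &
    (forall x, (0 <= g x)%E) : set T -> \bar R :=
  fun A => (\int[mu]_(x in A) g x)%E.

Local Notation nu := (density_measure mg g0).

Let nu0 : nu set0 = 0%E.
Proof. by rewrite /density_measure integral_set0. Qed.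

Let nu_ge0 A : (0 <= nu A)%E.
Proof. by apply: integral_ge0 => x _; exact: g0. Qed.

Let nu_sigma_additive : semi_sigma_additive nu.
Proof.
move=> F mF tF mUF; rewrite /density_measure; apply: cvg_toP.
  apply: ereal_nondecreasing_is_cvgn => m n mn.
  by apply: lee_sum_nneg_natr => // k _ _; apply: integral_ge0.
by rewrite ge0_integral_bigcup//; exact: measurable_funTS.
Qed.

HB.instance Definition _ := isMeasure.Build _ _ _ nu
  nu0 nu_ge0 nu_sigma_additive.

End density_measure.

(** * Cross inequalities and equality cases for integrals *)

Section integral_lemmas.
Context d (T : measurableType d) (R : realType).
Variable mu : {measure set T -> \bar R}.
Local Open Scope ereal_scope.

Lemma ae_imply (P Q : T -> Prop) : (forall x, P x -> Q x) ->
  {ae mu, forall x, P x} -> {ae mu, forall x, Q x}.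
Proof. by move=> PQ; apply: filterS. Qed.

Lemma ae_imply2 (P Q S : T -> Prop) : (forall x, P x -> Q x -> S x) ->
  {ae mu, forall x, P x} -> {ae mu, forall x, Q x} -> {ae mu, forall x, S x}.
Proof. by move=> PQ; apply: filterS2. Qed.

(** Integrating the pointwise cross inequality over x in [J] and then over y in [K] preserves it.
    This carries the MLR property from f to integrals of f over ordered sets. *)
Lemma integral_mul_le (J K : set T) (p q : T -> \bar R) :
  measurable J -> measurable K ->
  measurable_fun setT p -> measurable_fun setT q ->
  (forall x, 0 <= p x) -> (forall x, 0 <= q x) ->
  (forall x y, J x -> K y -> p y * q x <= p x * q y) ->
  \int[mu]_(y in K) p y * \int[mu]_(x in J) q x <=
  \int[mu]_(x in J) p x * \int[mu]_(y in K) q y.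
Proof.
move=> mJ mK mp mq p0 q0 pq.
have mpS D : measurable_fun D p by exact: measurable_funTS.
have mqS D : measurable_fun D q by exact: measurable_funTS.
have ip D : 0 <= \int[mu]_(x in D) p x by exact: integral_ge0.
have iq D : 0 <= \int[mu]_(x in D) q x by exact: integral_ge0.
rewrite -ge0_integralZr// -ge0_integralZl//.
apply: ge0_le_integral => //=.
- by move=> y _; rewrite mule_ge0.
- by apply: emeasurable_funM => //; exact: measurable_cst.
- by apply: emeasurable_funM => //; exact: measurable_cst.
move=> y Ky; rewrite -ge0_integralZl// -ge0_integralZr//.
apply: ge0_le_integral => //=.
- by move=> x _; rewrite mule_ge0.
- by apply: emeasurable_funM => //; exact: measurable_cst.
- by apply: emeasurable_funM => //; exact: measurable_cst.
- by move=> x Jx; exact: pq.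
Qed.

Lemma ge0_integral_setID (A B : set T) (h : T -> \bar R) :
  measurable A -> measurable B -> measurable_fun setT h ->
  (forall x, 0 <= h x) ->
  \int[mu]_(x in A) h x =
  \int[mu]_(x in A `\` B) h x + \int[mu]_(x in A `&` B) h x.
Proof.
move=> mA mB mh h0.
have {1}-> : A = (A `\` B) `|` (A `&` B).
  by rewrite setUC -[LHS](setUIDK A B).
rewrite ge0_integral_setU//.
- exact: measurableD.
- exact: measurableI.
- exact: measurable_funTS.
- by rewrite disj_set2E setIC setDE setIACA setICr setI0.
Qed.

(** The nonnegative function v - u has integral zero, hence vanishes almost everywhere; finiteness
    of the integral of u permits the cancellation. Strict domination rests on this equality case. *)
Lemma ae_eq_of_le_integral (D : set T) (u v : T -> R) :
  measurable D -> measurable_fun D u -> measurable_fun D v ->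
  (forall x, D x -> (0 <= u x <= v x)%R) ->
  \int[mu]_(x in D) (u x)%:E < +oo ->
  \int[mu]_(x in D) (v x)%:E <= \int[mu]_(x in D) (u x)%:E ->
  {ae mu, forall x, D x -> u x = v x}.
Proof.
move=> mD mu_ mv uv ufin vu.
have mvu : measurable_fun D (fun x => (v x - u x)%:E).
  by apply/measurable_EFinP; exact: measurable_funB.
have vu0 x : D x -> 0 <= (v x - u x)%:E.
  by move=> /uv /andP[_]; rewrite lee_fin subr_ge0.
have : \int[mu]_(x in D) (v x)%:E =
    \int[mu]_(x in D) (u x)%:E + \int[mu]_(x in D) (v x - u x)%:E.
  rewrite -ge0_integralD//=.
  - by apply: eq_integral => x _; rewrite -EFinD subrKC.
  - by move=> x /uv /andP[]; rewrite lee_fin.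
  - exact/measurable_EFinP.
move=> E; have I0 : \int[mu]_(x in D) (v x - u x)%:E = 0.
  apply/eqP; rewrite eq_le integral_ge0// andbT.
  move: vu; rewrite E -[leRHS]adde0 leeD2lE// ge0_fin_numE//.
  by apply: integral_ge0 => x /uv /andP[]; rewrite lee_fin.
have /ae_eq_integral_abs : \int[mu]_(x in D) `|(v x - u x)%:E| = 0.
  by rewrite -{}I0; apply: eq_integral => x /[1!inE] /vu0 /gee0_abs.
move=> /(_ mD mvu); apply: filterS => x h Dx.
by move: (h Dx) => /= -[/eqP]; rewrite subr_eq0 => /eqP ->.
Qed.

End integral_lemmas.

(** * Almost everywhere statements on intervals of positive length *)

Section integral_interval.
Context (R : realType).
Notation mu := (@lebesgue_measure R).

Lemma ae_exists_itv (p q : R) (P : R -> Prop) : p < q ->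
  {ae mu, forall x, P x} -> exists2 x, p < x < q & P x.
Proof.
move=> pq [N [mN N0 PN]]; apply: contrapT => nP.
have : (mu `]p, q[%classic <= mu N)%E.
  apply: le_measure; rewrite ?inE// => x /=; rewrite in_itv/= => xpq.
  by apply: PN => /= Px; apply: nP; exists x.
by rewrite N0 lebesgue_measure_itv/= lte_fin pq -EFinB lee_fin leNgt subr_gt0 pq.
Qed.

Lemma integral_gt0_itv (D : set R) (u : R -> \bar R) (p q : R) :
  measurable D -> measurable_fun D u -> (forall x, D x -> (0 <= u x)%E) ->
  p < q -> (forall x, p < x < q -> D x /\ (0 < u x)%E) ->
  (0 < \int[mu]_(x in D) u x)%E.
Proof.
move=> mD mf u0 pq up; rewrite lt_neqAle integral_ge0// andbT eq_sym.
apply/eqP => I0.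
have /ae_eq_integral_abs : (\int[mu]_(x in D) `|u x| = 0)%E.
  by rewrite -I0; apply: eq_integral => x /[1!inE] /u0 /gee0_abs.
move=> /(_ mD mf) /(ae_exists_itv pq)[x xpq] h.
by have [Dx] := up _ xpq; rewrite (h Dx) /= ltxx.
Qed.

End integral_interval.

(** * Windows of the density and consequences of the MLR property *)

Section convolution_window.
Context (R : realType) (f : R -> R).
Hypotheses (mf : measurable_fun [set: R] f) (f0 : forall x, 0 <= f x)
  (f1 : (\int[@lebesgue_measure R]_x (f x)%:E = 1)%E).
Notation mu := (@lebesgue_measure R).

Let mfD a : measurable_fun [set: R] (fun x => f (x + a)).
Proof. by apply: measurableT_comp => //; exact: measurable_funD. Qed.

Let mfB a : measurable_fun [set: R] (fun x => f (a - x)).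
Proof. by apply: measurableT_comp => //; exact: measurable_funB. Qed.

Let mefD a : measurable_fun [set: R] (fun x => (f (x + a))%:E).
Proof. by apply/measurable_EFinP; exact: mfD. Qed.

Let mefB a : measurable_fun [set: R] (fun x => (f (a - x))%:E).
Proof. by apply/measurable_EFinP; exact: mfB. Qed.

Lemma density_shift_le1 (D : set R) a : measurable D ->
  (\int[mu]_(x in D) (f (x + a))%:E <= 1)%E.
Proof.
move=> mD; apply: (@le_trans _ _ (\int[mu]_x (f (x + a))%:E)%E).
  apply: ge0_subset_integral => //; last by move=> x _; rewrite lee_fin.
  exact: mefD.
rewrite (@ge0_integral_translate _ a (EFin \o f)).
- by rewrite f1.
- exact/measurable_EFinP.
- by move=> x; rewrite lee_fin.
Qed.

(** The function G of the overview, a convolution of f with the indicator of [W]. For measurable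
    [W], [fine] loses nothing: the integral is at most the total mass 1 of f. *)
Definition window (W : set R) (z : R) : R :=
  fine (\int[mu]_(u in W) (f (z - u))%:E)%E.

(** The substitution x = z - u moves z from the integrand to the domain. Windows at z and at z + a
    thus become integrals over one set, of f and of its shift. *)
Lemma window_reflectE (W : set R) (z a : R) : measurable W ->
  (\int[mu]_(u in W) (f (z + a - u))%:E =
   \int[mu]_(x in [set x | W (z - x)%R]) (f (x + a))%:E)%E.
Proof.
move=> mW; pose h := (fun u : R => (f (z + a - u))%:E) \_ W.
have mh : measurable_fun [set: R] h.
  by apply/(measurable_restrictT _ mW)/measurable_funTS; exact: mefB.
have h0 x : (0 <= h x)%E by apply: erestrict_ge0 => y _; rewrite lee_fin.
rewrite integral_mkcond [RHS]integral_mkcond -(ge0_integral_reflect z mh h0).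
apply: eq_integral => x _; rewrite /h !patchE.
rewrite (_ : (z - x \in W) = (x \in [set x | W (z - x)])).
  by case: ifP => // _; congr (f _)%:E; ring.
by apply/idP/idP; rewrite !inE.
Qed.

Lemma measurable_reflect (W : set R) (z : R) : measurable W ->
  measurable [set x | W (z - x)].
Proof.
move=> mW; rewrite -[X in measurable X]setTI.
exact: (measurable_funB (measurable_cst z) (@measurable_id _ _ setT)).
Qed.

Lemma windowE (W : set R) (z : R) : measurable W ->
  (window W z)%:E = (\int[mu]_(u in W) (f (z - u))%:E)%E.
Proof.
move=> mW; rewrite /window fineK// ge0_fin_numE; last first.
  by apply: integral_ge0 => u _; rewrite lee_fin.
rewrite -[z]addr0 window_reflectE// (le_lt_trans _ (ltry 1))//.
by apply: density_shift_le1; exact: measurable_reflect.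
Qed.

Lemma window_ge0 (W : set R) (z : R) : 0 <= window W z.
Proof. by apply: fine_ge0; apply: integral_ge0 => u _; rewrite lee_fin. Qed.

Lemma measurable_window (W : set R) : measurable W ->
  measurable_fun setT (window W).
Proof.
move=> mW; apply: measurableT_comp => //.
(* With the indicator of [W] in the integrand, the window is the inner integral of a jointly
   measurable function, so Tonelli gives measurability. *)
rewrite (_ : (fun z => _) =
    (fubini_F mu (fun xy : R * R => (f (xy.1 - xy.2) * \1_W xy.2)%:E))).
  apply: measurable_fun_fubini_tonelli_F => //=.
  - apply/measurable_EFinP; apply: measurable_funM.
      by apply: measurableT_comp => //; exact: measurable_funB.
    by apply: measurableT_comp => //; exact: measurable_indic.
  - by move=> x; rewrite lee_fin mulr_ge0.
apply/funext => z; rewrite /fubini_F/= integral_mkcond.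
apply: eq_integral => u _; rewrite patchE indicE.
by case: ifP => _; rewrite ?mulr1 ?mulr0.
Qed.

Lemma window_gt0 (W : set R) (t0 p q z : R) : measurable W ->
  (forall u, 0 < u < t0 -> W u) ->
  (forall x, p < x < q -> 0 < f x) -> 0 < t0 -> p < q -> p < z -> z - t0 < q ->
  0 < window W z.
Proof.
move=> mW Wt fpq t00 pq pz zq; rewrite -lte_fin windowE//.
(* For u in this interval, u lies in [W] and z - u in ]p, q[; the hypotheses on z make the interval
   nonempty. *)
apply: (@integral_gt0_itv _ _ _ (Num.max 0 (z - q)) (Num.min t0 (z - p))) => //.
- by apply: measurable_funTS; exact: mefB.
- by move=> x _; rewrite lee_fin.
- by rewrite gt_max !lt_min t00 subr_gt0 pz/= ltrBlDr addrC -ltrBlDr zq ltrD2l ltrN2.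
- move=> u; rewrite gt_max lt_min => /andP[/andP[u0 zqu] /andP[ut uzp]].
  split; first by apply: Wt; rewrite u0.
  by rewrite lte_fin; apply: fpq; lra.
Qed.

Hypothesis fMLR : MLR f.

(** This is MLR at eta1 = - lam and eta2 = 0: the ratio f(z + lam) / f(z) is nonincreasing, written
    without division. The cases lam = 0 and x = y are equalities. *)
Lemma MLR_shift lam x y : 0 <= lam -> x <= y ->
  f (y + lam) * f x <= f (x + lam) * f y.
Proof.
rewrite le_eqVlt => /predU1P[<-|l0]; first by rewrite !addr0 mulrC.
rewrite le_eqVlt => /predU1P[->//|xy].
by have := fMLR xy (_ : - lam < 0); rewrite !subr0 !opprK mulrC; apply; rewrite oppr_lt0.
Qed.

(** Shifting by z - y gives f(z) f(x) <= f(x + z - y) f(y), so f(y) cannot vanish. The support of f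
    is therefore an interval. *)
Lemma MLR_support x y z : 0 < f x -> 0 < f z -> x <= y <= z -> 0 < f y.
Proof.
move=> fx fz /andP[xy yz].
have := @MLR_shift (z - y) x y; rewrite subr_ge0 => /(_ yz xy).
rewrite subrKC => h; rewrite lt_neqAle f0 andbT.
apply/eqP => fy; move: h; rewrite -fy mulr0 leNgt => /negP; apply.
exact: mulr_gt0.
Qed.

(** The window at z integrates f over z - [W]. Since [W] is an initial segment of the nonnegative
    reals, this set moves to the right with z, and G inherits the MLR property from f. *)
Lemma MLR_window (W : set R) (lam z c : R) : measurable W ->
  (forall u v : R, 0 <= u -> u <= v -> W v -> W u) -> (forall u, W u -> 0 <= u) ->
  0 <= lam -> z <= c ->
  window W (c + lam) * window W z <= window W (z + lam) * window W c.
Proof.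
move=> mW Wdc W0 l0 zc; rewrite -lee_fin !EFinM !windowE//.
rewrite !window_reflectE//.
(* The reflected windows of z and c split into consecutive pieces
   Iz `\` Ic, Iz `&` Ic and Ic `\` Iz, to which the cross inequality applies
   pairwise. *)
set Iz := [set x | W (z - x)]; set Ic := [set x | W (c - x)].
have Gz : (\int[mu]_(u in W) (f (z - u))%:E =
    \int[mu]_(x in Iz) (f (x + 0))%:E)%E by rewrite -window_reflectE// addr0.
have Gc : (\int[mu]_(u in W) (f (c - u))%:E =
    \int[mu]_(x in Ic) (f (x + 0))%:E)%E by rewrite -window_reflectE// addr0.
rewrite {}Gz {}Gc.
have mIz : measurable Iz by exact: measurable_reflect.
have mIc : measurable Ic by exact: measurable_reflect.
have mA : measurable (Iz `\` Ic) by exact: measurableD.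
have mB : measurable (Iz `&` Ic) by exact: measurableI.
have mC : measurable (Ic `\` Iz) by exact: measurableD.
(* If y < x, then c - x would be a nonnegative number below the element c - y of [W], hence in [W].
   The bound [IC] follows in the same way at z - y. *)
have AB x y : (Iz `\` Ic) x -> (Iz `&` Ic) y -> x <= y.
  move=> [/= zx cx] [/= zy cy]; rewrite leNgt; apply/negP => yx; apply: cx.
  by apply: (Wdc _ (c - y)) => //; [have := W0 _ zx; lra|lra].
have IC x y : Iz x -> (Ic `\` Iz) y -> x <= y.
  move=> /= zx [/= cy zy]; rewrite leNgt; apply/negP => yx; apply: zy.
  by apply: (Wdc _ (c - y)) => //; [have := W0 _ zx; lra|lra].
have cross (J K : set R) : measurable J -> measurable K ->
    (forall x y, J x -> K y -> x <= y) ->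
    (\int[mu]_(y in K) (f (y + lam))%:E * \int[mu]_(x in J) (f (x + 0))%:E <=
     \int[mu]_(x in J) (f (x + lam))%:E * \int[mu]_(y in K) (f (y + 0))%:E)%E.
  move=> mJ mK JK; apply: integral_mul_le => //.
  - exact: mefD.
  - exact: mefD.
  - by move=> x; rewrite lee_fin.
  - by move=> x; rewrite lee_fin.
  - by move=> x y Jx Ky; rewrite -!EFinM lee_fin !addr0 MLR_shift// JK.
have := cross _ _ mA mB AB.
have := cross _ _ mA mC (fun x y (Ax : (Iz `\` Ic) x) => IC x y Ax.1).
have := cross _ _ mB mC (fun x y (Bx : (Iz `&` Ic) x) => IC x y Bx.1).
have fin a (D : set R) : measurable D ->
    exists r, (\int[mu]_(x in D) (f (x + a))%:E = r%:E)%E.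
  move=> mD; eexists; symmetry; apply: fineK.
  rewrite ge0_fin_numE ?(le_lt_trans (density_shift_le1 a mD)) ?ltry//.
  by apply: integral_ge0 => u _; rewrite lee_fin.
have split a : (\int[mu]_(x in Iz) (f (x + a))%:E =
    \int[mu]_(x in Iz `\` Ic) (f (x + a))%:E +
    \int[mu]_(x in Iz `&` Ic) (f (x + a))%:E)%E.
  apply: ge0_integral_setID => //; first exact: mefD.
  by move=> x; rewrite lee_fin.
have split' a : (\int[mu]_(x in Ic) (f (x + a))%:E =
    \int[mu]_(x in Ic `\` Iz) (f (x + a))%:E +
    \int[mu]_(x in Iz `&` Ic) (f (x + a))%:E)%E.
  rewrite [in X in (_ + X)%E]setIC.
  apply: ge0_integral_setID => //; first exact: mefD.
  by move=> x; rewrite lee_fin.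
rewrite !split !split'.
have [pA ->] := fin lam _ mA; have [pB ->] := fin lam _ mB.
have [pC ->] := fin lam _ mC; have [qA ->] := fin 0 _ mA.
have [qB ->] := fin 0 _ mB; have [qC ->] := fin 0 _ mC.
(* After expansion the common term [pB * qB] cancels, and the sum of the three cross inequalities
   remains. *)
rewrite -!EFinD -!EFinM !lee_fin => h1 h2 h3; lra.
Qed.

Lemma density_le1 (D : set R) : measurable D ->
  (\int[mu]_(x in D) (f x)%:E <= 1)%E.
Proof.
move=> mD; have := density_shift_le1 0 mD.
by under eq_integral do rewrite addr0.
Qed.

(** A function positive at no more than one point has integral 0, not 1. *)
Lemma density_gt0_pair : exists p q, [/\ p < q, 0 < f p & 0 < f q].
Proof.
apply: contrapT => nex.
have [x0 fx0] : exists x0, forall x, x != x0 -> f x = 0.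
  have [[x0 fx0]|nf] := pselect (exists x0, 0 < f x0).
    exists x0 => x xx0; apply/eqP; rewrite eq_le f0 andbT leNgt.
    apply/negP => fx; apply: nex.
    by move: xx0; rewrite neq_lt => /orP[xx0|xx0]; [exists x, x0|exists x0, x].
  exists 0 => x _; apply/eqP; rewrite eq_le f0 andbT leNgt.
  by apply/negP => fx; apply: nf; exists x.
suff : (\int[mu]_x (f x)%:E = 0)%E by rewrite f1 => -[] /eqP; rewrite oner_eq0.
rewrite (@ge0_negligible_integral _ _ _ mu setT [set x0])//.
- by apply: integral0_eq => x [_ /= /eqP/fx0 ->].
- exact/measurable_EFinP.
- by move=> x _; rewrite lee_fin.
- exact: lebesgue_measure_set1.
Qed.

(** The intervals []a, a + n.+1%:R^-1]] decrease to the empty set, so their masses tend to 0 by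
    continuity from above. *)
Lemma small_right_mass (a e : R) : 0 < e ->
  exists2 b, a < b & (\int[mu]_(x in `]a, b]) (f x)%:E < e%:E)%E.
Proof.
move=> e0.
have mF : measurable_fun [set: R] (EFin \o f) by exact/measurable_EFinP.
have F0 x : (0 <= (EFin \o f) x)%E by rewrite lee_fin.
pose nu : {measure set _ -> \bar R} := @density_measure _ _ _ mu _ mF F0.
pose D n : set R := `]a, a + n.+1%:R^-1]%classic.
have mD n : measurable (D n) by exact: measurable_itv.
have capD : \bigcap_n D n = set0.
  rewrite -subset0 => x /= Dx; have ax : 0 < x - a.
    by have := Dx 0%N I; rewrite /D/= in_itv/= subr_gt0 => /andP[].
  have [n] := ltr_add_invr ax.
  rewrite add0r => nx; have := Dx n I; rewrite /D/= in_itv/= => /andP[_].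
  by rewrite leNgt => /negP; apply; rewrite -ltrBrDl.
have : nu \o D @ \oo --> nu (\bigcap_n D n).
  apply: nonincreasing_cvg_mu => //.
  - rewrite /nu /density_measure/= (@le_lt_trans _ _ 1%E) ?ltry//.
    exact: (density_le1 (mD 0%N)).
  - by apply: bigcapT_measurable.
  - move=> m n mn; apply/subsetPset => x; rewrite /D/= !in_itv/=.
    move=> /andP[-> /le_trans]; apply; rewrite lerD2l lef_pV2 ?posrE//.
    by rewrite ler_nat.
rewrite capD measure0 => /fine_cvgP[_ /cvgrPdist_lt/(_ _ e0)[n _ /(_ n (leqnn n))]].
rewrite /= sub0r normrN => h; exists (a + n.+1%:R^-1).
  by rewrite ltrDl invr_gt0.
rewrite -[X in (X < _)%E]fineK ?lte_fin; last first.
  rewrite ge0_fin_numE; last by apply: integral_ge0 => x _; rewrite lee_fin.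
  rewrite (@le_lt_trans _ _ 1%E) ?ltry//.
  exact: (density_le1 (mD n)).
exact: (le_lt_trans (ler_norm _) h).
Qed.

(** In reflected form the window integrates f over the x with z - x in [W], and points where f
    vanishes contribute nothing. *)
Lemma window_le_mass (W : set R) (z : R) (D : set R) : measurable W ->
  measurable D -> (forall x, W (z - x) -> f x != 0 -> D x) ->
  ((window W z)%:E <= \int[mu]_(x in D) (f x)%:E)%E.
Proof.
move=> mW mD WD; rewrite windowE// -[z]addr0 window_reflectE//.
under eq_integral do rewrite addr0.
have mI := measurable_reflect z mW.
rewrite integral_mkcond [leRHS]integral_mkcond.
apply: ge0_le_integral => //.
- by move=> x _; apply: erestrict_ge0 => y _; rewrite lee_fin.
- by apply/(measurable_restrictT _ mI)/measurable_funTS/measurable_EFinP.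
- by apply/(measurable_restrictT _ mD)/measurable_funTS/measurable_EFinP.
move=> x _; rewrite !patchE; case: ifPn => [|_]; last first.
  by case: ifP => // _; rewrite lee_fin.
rewrite inE/= => Wx; have [->|fx0] := eqVneq (f x) 0; first by case: ifP.
by rewrite mem_set//; apply: WD.
Qed.

Lemma window_ge_mass (W : set R) (z : R) (D : set R) : measurable W ->
  measurable D -> (forall x, D x -> W (z - x)) ->
  (\int[mu]_(x in D) (f x)%:E <= (window W z)%:E)%E.
Proof.
move=> mW mD DW; rewrite windowE// -[z]addr0 window_reflectE//.
under [leRHS]eq_integral do rewrite addr0.
apply: ge0_subset_integral => //.
- exact: measurable_reflect.
- exact/measurable_EFinP/measurable_funTS.
- by move=> x _; rewrite lee_fin.
Qed.

Lemma window_le1 (W : set R) (z : R) : measurable W -> window W z <= 1.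
Proof.
move=> mW; rewrite -lee_fin -f1.
exact: window_le_mass.
Qed.

(** * Balance of the gap density on the two sides of c, carried from lam = 0 to every lam *)

Section balance.
Variable W : set R.
Hypotheses (mW : measurable W)
  (Wdc : forall u v : R, 0 <= u -> u <= v -> W v -> W u)
  (W0 : forall u, W u -> 0 <= u).
Local Notation g := (window W).

(* The density at z of X_(2) - theta_(2) restricted to the event U \in W, when
   lam = |theta_1 - theta_2|; see gap_law. *)
Definition gap_density (lam z : R) : R := f (z + lam) * g z + f z * g (z + lam).

Let mg : measurable_fun [set: R] g. Proof. exact: measurable_window. Qed.

Let mgD a : measurable_fun [set: R] (fun z => g (z + a)).
Proof. by apply: measurableT_comp => //; exact: measurable_funD. Qed.

Lemma measurable_gap_density lam : measurable_fun [set: R] (gap_density lam).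
Proof. by apply: measurable_funD; apply: measurable_funM. Qed.

Let meh lam (D : set R) :
  measurable_fun D (fun z => (gap_density lam z)%:E).
Proof.
by apply: measurable_funTS; apply/measurable_EFinP; exact: measurable_gap_density.
Qed.

Lemma gap_density_ge0 lam z : 0 <= gap_density lam z.
Proof. by rewrite addr_ge0// mulr_ge0// window_ge0. Qed.

Let h0 lam z : (0 <= (gap_density lam z)%:E)%E.
Proof. by rewrite lee_fin gap_density_ge0. Qed.

Lemma gap_density_lty lam (D : set R) : measurable D ->
  (\int[mu]_(z in D) (gap_density lam z)%:E < +oo)%E.
Proof.
move=> mD; have mfl : measurable_fun D (fun z : R => (f (z + lam))%:E).
  exact: (measurable_funTS (mefD lam)).
have mfz : measurable_fun D (fun z : R => (f z)%:E).
  exact/measurable_funTS/measurable_EFinP.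
apply: (@le_lt_trans _ _ (\int[mu]_(z in D) ((f (z + lam))%:E + (f z)%:E))%E).
  apply: ge0_le_integral => //.
  - exact: meh.
  - exact: (emeasurable_funD mfl mfz).
  - move=> z _; rewrite -EFinD lee_fin lerD//.
      by rewrite -[leRHS]mulr1 ler_wpM2l// window_le1.
    by rewrite -[leRHS]mulr1 ler_wpM2l// window_le1.
rewrite ge0_integralD//; last 2 first.
- by move=> z _; rewrite lee_fin.
- by move=> z _; rewrite lee_fin.
by rewrite (le_lt_trans (leeD (density_shift_le1 lam mD) (density_le1 mD)))// ltry.
Qed.

Lemma gap_density_ratio_le lam c z : 0 <= lam -> 0 < f c -> 0 < g c ->
  z <= c ->
  (f (c + lam) / f c) * f z <= f (z + lam) /\
  (g (c + lam) / g c) * g z <= g (z + lam).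
Proof.
move=> l0 fc gc zc; split.
  by rewrite mulrAC ler_pdivrMr// MLR_shift.
by rewrite mulrAC ler_pdivrMr// MLR_window.
Qed.

Lemma gap_density_ratio_ge lam c z : 0 <= lam -> 0 < f c -> 0 < g c ->
  c <= z ->
  f (z + lam) <= (f (c + lam) / f c) * f z /\
  g (z + lam) <= (g (c + lam) / g c) * g z.
Proof.
move=> l0 fc gc cz; split.
  by rewrite mulrAC ler_pdivlMr// MLR_shift.
by rewrite mulrAC ler_pdivlMr// MLR_window.
Qed.

Variable t0 : R.
Hypotheses (t0_gt0 : 0 < t0) (Wt0 : W t0).

Let Wt u : 0 < u < t0 -> W u.
Proof. by move=> /andP[u0 ut]; apply: (Wdc _ _ Wt0); rewrite ltW. Qed.

Lemma window_support_gt0 p q z : 0 < f p -> 0 < f q -> p < q ->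
  p < z -> z - t0 < q -> 0 < g z.
Proof.
move=> fp fq pq; apply: (window_gt0 mW Wt _ t0_gt0 pq) => x /andP[px xq].
by apply: (MLR_support fp fq); rewrite !ltW.
Qed.

Lemma gap_density0_integral_gt0 (D : set R) p q : measurable D ->
  0 < f p -> 0 < f q -> p < q -> `]p, q[ `<=` D ->
  (0 < \int[mu]_(z in D) (gap_density 0 z)%:E)%E.
Proof.
move=> mD fp fq pq pqD; apply: (integral_gt0_itv mD _ _ pq) => //.
move=> x /andP[px xq]; split; first by apply: pqD; rewrite /= in_itv/= px.
rewrite lte_fin /gap_density !addr0.
have fx : 0 < f x by apply: (MLR_support fp fq); rewrite !ltW.
have gx : 0 < g x by apply: (window_support_gt0 fp fq) => //; move: t0_gt0; lra.
by rewrite addr_gt0// mulr_gt0.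
Qed.

Variable c : R.
Hypothesis base : (\int[mu]_(z in `]c, +oo[) (gap_density 0 z)%:E <=
  \int[mu]_(z in `]-oo, c]) (gap_density 0 z)%:E)%E.

(** If f had no mass to the left of c, the left integral in [base] would be 0 and the right one
    positive. So either the right side is empty, or c is interior to the support and the ratios at c
    make sense. *)
Lemma balance_cases : (forall w, c < w -> f w = 0) \/
  exists z w, [/\ z < c, c < w, 0 < f z, 0 < f w & (0 < f c) && (0 < g c)].
Proof.
have [[w cw fw]|nw] := pselect (exists2 w, c < w & 0 < f w); last first.
  left=> w cw; apply/eqP; rewrite eq_le f0 andbT leNgt; apply/negP => fw.
  by apply: nw; exists w.
right; have [[z zc fz]|nz] := pselect (exists2 z, z < c & 0 < f z).
  exists z, w; split => //.
  rewrite (MLR_support fz fw) ?ltW//=.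
  by apply: (window_support_gt0 fz fw) => //; move: t0_gt0; lra.
have fl z : z < c -> f z = 0.
  move=> zc; apply/eqP; rewrite eq_le f0 andbT leNgt; apply/negP => fz.
  by apply: nz; exists z.
have [p [q [pq fp fq]]] := density_gt0_pair.
have cp : c <= p by rewrite leNgt; apply/negP => /fl pE; move: fp; rewrite pE ltxx.
exfalso; move: base; apply/negP; rewrite -ltNge.
rewrite -integral_itv_bndo_bndc; last exact: meh.
rewrite integral0_eq; last first.
  move=> z /=; rewrite in_itv/= => zc.
  by rewrite /gap_density addr0 fl// !mul0r addr0.
apply: (gap_density0_integral_gt0 _ fp fq pq) => //.
by move=> x /=; rewrite !in_itv/= andbT => /andP[px _]; exact: le_lt_trans px.
Qed.

(** At lam = 0 the density is 2 f G, so multiplying it by the mean [k] of the ratios of f and G at c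
    leaves one term for each ratio. These two terms compare separately with those of
    [gap_density lam]. *)
Lemma gap_density_ratio lam : 0 <= lam -> 0 < f c -> 0 < g c ->
  let k := (f (c + lam) / f c + g (c + lam) / g c) / 2 in
  [/\ 0 <= k,
    (forall z, k * gap_density 0 z =
      (f (c + lam) / f c) * f z * g z + f z * ((g (c + lam) / g c) * g z)),
    (forall z, z <= c -> k * gap_density 0 z <= gap_density lam z) &
    (forall z, c <= z -> gap_density lam z <= k * gap_density 0 z)].
Proof.
move=> l0 fc gc k.
have kE z : k * gap_density 0 z =
    (f (c + lam) / f c) * f z * g z + f z * ((g (c + lam) / g c) * g z).
  by rewrite /gap_density !addr0 /k; field; rewrite !gt_eqF.
split => //.
- by rewrite divr_ge0// addr_ge0// divr_ge0// ?window_ge0// ltW.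
- move=> z zc; have [h1 h2] := gap_density_ratio_le l0 fc gc zc.
  by rewrite kE lerD// ?ler_wpM2r ?ler_wpM2l// window_ge0.
- move=> z zc; have [h1 h2] := gap_density_ratio_ge l0 fc gc zc.
  by rewrite kE lerD// ?ler_wpM2r ?ler_wpM2l// window_ge0.
Qed.

Let ZlE k (D : set R) : measurable D -> 0 <= k ->
  (\int[mu]_(z in D) (k * gap_density 0 z)%:E =
   k%:E * \int[mu]_(z in D) (gap_density 0 z)%:E)%E.
Proof.
by move=> mD k0; rewrite -ge0_integralZl//; exact: meh.
Qed.

Let mekh k (D : set R) :
  measurable_fun D (fun z => (k * gap_density 0 z)%:E).
Proof.
apply: measurable_funTS; apply/measurable_EFinP; apply: measurable_funM => //.
exact: measurable_gap_density.
Qed.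

(** The function [k * gap_density 0] lies above [gap_density lam] to the right of c and below it to
    the left, so [base], scaled by [k], fits between the two integrals. *)
Lemma balance_weak lam : 0 <= lam ->
  (\int[mu]_(z in `]c, +oo[) (gap_density lam z)%:E <=
   \int[mu]_(z in `]-oo, c]) (gap_density lam z)%:E)%E.
Proof.
move=> l0; have [fr|[z [w [zc cw fz fw /andP[fc gc]]]]] := balance_cases.
  rewrite integral0_eq; first by apply: integral_ge0.
  move=> z /=; rewrite in_itv/= andbT => cz.
  by rewrite /gap_density !fr// ?mul0r ?addr0//; lra.
have [k0 _ kJ kK] := gap_density_ratio l0 fc gc; move: k0 kJ kK.
set k := (_ / 2) => k0 kJ kK.
apply: (@le_trans _ _ (\int[mu]_(z in `]c, +oo[) (k * gap_density 0 z)%:E)%E).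
  apply: ge0_le_integral => //; [exact: meh|exact: mekh|].
  by move=> x /=; rewrite in_itv/= andbT lee_fin => cx; apply: kK; rewrite ltW.
apply: (@le_trans _ _ (\int[mu]_(z in `]-oo, c]) (k * gap_density 0 z)%:E)%E).
  by rewrite !ZlE//; apply: lee_wpmul2l => //; rewrite lee_fin.
apply: ge0_le_integral => //.
- by move=> x _; rewrite lee_fin mulr_ge0// gap_density_ge0.
- exact: mekh.
- exact: meh.
Qed.

Lemma integral_shift_ray lam :
  (\int[mu]_(z in `]-oo, c]) (f (z + lam))%:E =
   \int[mu]_(z in `]-oo, (c + lam)%R]) (f z)%:E)%E.
Proof.
rewrite integral_mkcond [RHS]integral_mkcond.
have mI : measurable (`]-oo, (c + lam)%R]%classic : set R).
  exact: measurable_itv.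
rewrite -(@ge0_integral_translate _ lam (_ \_ `]-oo, c + lam]%classic)).
- apply: eq_integral => z _; rewrite !patchE !mem_setE/= !in_itv/=.
  by rewrite lerD2r.
- by apply/(measurable_restrictT _ mI)/measurable_funTS/measurable_EFinP.
- by move=> x; apply: erestrict_ge0 => y _; rewrite lee_fin.
Qed.

(** Periodicity would give the rays up to c and up to c + lam equal finite mass, yet f is positive
    just to the right of c. *)
Lemma not_periodic_density lam w : 0 < lam -> 0 < f c -> c < w -> 0 < f w ->
  ~ {ae mu, forall z, f (z + lam) = f z}.
Proof.
move=> l0 fc cw fw fE.
have mJ : measurable (`]-oo, c]%classic : set R) by exact: measurable_itv.
have mI : measurable (`]-oo, (c + lam)%R]%classic : set R).
  exact: measurable_itv.
have : (\int[mu]_(z in `]-oo, c]) (f (z + lam))%:E =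
        \int[mu]_(z in `]-oo, c]) (f z)%:E)%E.
  apply: ae_eq_integral => //.
  - exact: (measurable_funTS (mefD lam)).
  - exact/measurable_funTS/measurable_EFinP.
  - by move: fE; apply: ae_imply => z /= ->.
rewrite integral_shift_ray.
have mF : measurable_fun [set: R] (EFin \o f) by exact/measurable_EFinP.
have F0 x : (0 <= (EFin \o f) x)%E by rewrite lee_fin.
rewrite (ge0_integral_setID mu mI mJ mF F0).
rewrite (_ : _ `&` _ = `]-oo, c]%classic); last first.
  apply/seteqP; split => x/=; first by case.
  by rewrite !in_itv/= => xc; split=> //; rewrite (le_trans xc)// lerDl ltW.
have fin D : measurable D ->
    exists r, (\int[mu]_(z in D) (f z)%:E = r%:E)%E.
  move=> mD; eexists; symmetry; apply: fineK.
  rewrite ge0_fin_numE ?(le_lt_trans (density_le1 mD)) ?ltry//.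
  by apply: integral_ge0 => x _; rewrite lee_fin.
have mIJ := measurableD mI mJ.
have : (0 < \int[mu]_(z in `]-oo, (c + lam)%R] `\` `]-oo, c]) (f z)%:E)%E.
  apply: (@integral_gt0_itv _ _ _ c (Num.min (c + lam) w)) => //.
  - exact/measurable_funTS/measurable_EFinP.
  - by move=> x _; rewrite lee_fin.
  - by rewrite lt_min ltrDl l0.
  - move=> x; rewrite lt_min => /and3P[cx xcl xw]; rewrite /= !in_itv/=.
    split; last by rewrite lte_fin (MLR_support fc fw) ?ltW.
    by split; [exact: ltW|apply/negP; rewrite -ltNge].
have [a ->] := fin _ mIJ; have [j ->] := fin _ mJ.
by rewrite lte_fin -EFinD => a0 [/eqP]; rewrite -subr_eq0 addrK gt_eqF.
Qed.

Lemma balance_strict lam p q : 0 < lam -> 2 * lam <= t0 ->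
  0 < f p -> 0 < f q -> lam < q - p ->
  (\int[mu]_(z in `]c, +oo[) (gap_density lam z)%:E <
   \int[mu]_(z in `]-oo, c]) (gap_density lam z)%:E)%E.
Proof.
move=> l0 lt0 fp fq lpq.
have pq : p < q by lra.
have [fr|[z0 [w [zc cw fz fw /andP[fc gc]]]]] := balance_cases.
  (* With no mass beyond c the right integral is 0. The left one is positive because f(x) G(x + lam)
     > 0 for x in ]p, q - lam[. *)
  rewrite integral0_eq; last first.
    move=> z /=; rewrite in_itv/= andbT => cz.
    by rewrite /gap_density !fr// ?mul0r ?addr0//; lra.
  have qc : q <= c.
    by rewrite leNgt; apply/negP => /fr qE; move: fq; rewrite qE ltxx.
  apply: (@integral_gt0_itv _ _ _ p (q - lam)).
  - exact: measurable_itv.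
  - exact: meh.
  - by move=> x _; rewrite lee_fin gap_density_ge0.
  - by lra.
  move=> x /andP[px xq]; rewrite /= in_itv/=; split; first by lra.
  have fx : 0 < f x by apply: (MLR_support fp fq); apply/andP; split; lra.
  have gx : 0 < g (x + lam).
    by apply: (window_support_gt0 fp fq pq); move: t0_gt0; lra.
  by rewrite lte_fin ltr_wpDl ?mulr_gt0// mulr_ge0// window_ge0.
rewrite ltNge; apply/negP => JK.
have [] := gap_density_ratio (ltW l0) fc gc.
set k := (_ / 2); set r := f (c + lam) / f c; set s := g (c + lam) / g c.
move=> k0 kE kJ kK.
have mJ : measurable (`]-oo, c]%classic : set R) by exact: measurable_itv.
have mK : measurable (`]c, +oo[%classic : set R) by exact: measurable_itv.
have kh0 z : 0 <= k * gap_density 0 z by rewrite mulr_ge0// gap_density_ge0.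
have IK : (\int[mu]_(z in `]c, +oo[) (gap_density lam z)%:E <=
    \int[mu]_(z in `]c, +oo[) (k * gap_density 0 z)%:E)%E.
  apply: ge0_le_integral => //; [exact: meh|exact: mekh|].
  by move=> x /=; rewrite in_itv/= andbT lee_fin => cx; apply: kK; rewrite ltW.
have IKJ : (\int[mu]_(z in `]c, +oo[) (k * gap_density 0 z)%:E <=
    \int[mu]_(z in `]-oo, c]) (k * gap_density 0 z)%:E)%E.
  by rewrite !ZlE//; apply: lee_wpmul2l => //; rewrite lee_fin.
have IJ : (\int[mu]_(z in `]-oo, c]) (k * gap_density 0 z)%:E <=
    \int[mu]_(z in `]-oo, c]) (gap_density lam z)%:E)%E.
  apply: ge0_le_integral => //; [|exact: mekh|exact: meh].
  by move=> z _; rewrite lee_fin.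
have mh (D : set R) : measurable_fun D (gap_density lam).
  by apply/measurable_EFinP; exact: meh.
have mkh (D : set R) : measurable_fun D (fun z => k * gap_density 0 z).
  by apply/measurable_EFinP; exact: mekh.
(* [JK] closes the chain [IK], [IKJ], [IJ] into a cycle, so all four integrals agree and the
   pointwise bounds are equalities almost everywhere. *)
have aeJ : {ae mu, forall z, `]-oo, c]%classic z ->
    k * gap_density 0 z = gap_density lam z}.
  apply: (@ae_eq_of_le_integral _ _ _ mu _ (fun z => k * gap_density 0 z)
    (gap_density lam) mJ (mkh _) (mh _)).
  - by move=> z /=; rewrite in_itv/= => zc'; rewrite kh0 kJ.
  - by apply: le_lt_trans (gap_density_lty lam mJ).
  - exact: le_trans JK (le_trans IK IKJ).
have aeK : {ae mu, forall z, `]c, +oo[%classic z ->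
    gap_density lam z = k * gap_density 0 z}.
  apply: (@ae_eq_of_le_integral _ _ _ mu _ (gap_density lam)
    (fun z => k * gap_density 0 z) mK (mh _) (mkh _)).
  - move=> z /=; rewrite in_itv/= andbT => zc'.
    by rewrite gap_density_ge0 kK// ltW.
  - exact: gap_density_lty.
  - exact: le_trans IKJ (le_trans IJ JK).
(* On either side of c both terms are bounded in the same direction, so equality of the sums forces
   equality of each term. *)
have sep z : k * gap_density 0 z = gap_density lam z ->
    r * f z * g z = f (z + lam) * g z /\
    f z * (s * g z) = f z * g (z + lam).
  rewrite kE /gap_density; have fz0 := f0 z; have gz0 := window_ge0 W z.
  have [zc'|/ltW zc'] := leP z c.
    have [h1 h2] := gap_density_ratio_le (ltW l0) fc gc zc'.
    have := ler_wpM2r gz0 h1; have := ler_wpM2l fz0 h2; rewrite -/r -/s; lra.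
  have [h1 h2] := gap_density_ratio_ge (ltW l0) fc gc zc'.
  have := ler_wpM2r gz0 h1; have := ler_wpM2l fz0 h2; rewrite -/r -/s; lra.
have [[x0 x0P]|nx0] := pselect (exists x0, forall y, y < x0 -> f y = 0).
  (* The support has a left endpoint a; as z decreases to a, g z tends to 0
     but g (z + lam) does not. *)
  pose S := [set y | 0 < f y]; pose a := inf S.
  have infS : has_inf S.
    split; first by exists c.
    exists x0 => y Sy; rewrite leNgt; apply/negP => /x0P fy.
    by move: Sy; rewrite /S/= fy ltxx.
  have fa y : f y != 0 -> a <= y.
    by move=> fy; apply: ge_inf; [exact: infS.2|rewrite /S/= lt_neqAle eq_sym fy f0].
  have fac y : a < y -> y <= c -> 0 < f y.
    move=> ay yc; have ya : 0 < y - a by rewrite subr_gt0.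
    have [y' Sy'] := inf_adherent ya infS.
    by rewrite subrKC => y'y; apply: (MLR_support Sy' fc); rewrite yc ltW.
  have ac : a < c by rewrite (le_lt_trans _ zc)// fa// gt_eqF.
  pose D : set R := `]a, a + lam]%classic.
  have mD : measurable D by exact: measurable_itv.
  have D0 : (0 < \int[mu]_(x in D) (f x)%:E)%E.
    apply: (@integral_gt0_itv _ _ _ a (Num.min (a + lam) c)) => //.
    - exact/measurable_funTS/measurable_EFinP.
    - by move=> x _; rewrite lee_fin.
    - by rewrite lt_min ltrDl l0.
    - move=> x; rewrite lt_min => /and3P[ax xal xc].
      by rewrite /D/= in_itv/= ax ltW//= lte_fin fac// ltW.
  have [dr drE] : exists dr, (\int[mu]_(x in D) (f x)%:E = dr%:E)%E.
    eexists; symmetry; apply: fineK.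
    by rewrite ge0_fin_numE ?(le_lt_trans (density_le1 mD)) ?ltry// ltW.
  have dr0 : 0 < dr by rewrite -lte_fin -drE.
  have s0 : 0 <= s by rewrite divr_ge0 ?window_ge0.
  have s1 : 0 < s + 1 by rewrite ltr_pwDr.
  (* With G(z) < dr / (s + 1), s G(z) stays below dr <= G(z + lam), against equality of the two. The
     summand 1 covers s = 0; the bound by dr uses 2 lam <= t0. *)
  have [b ab bd] := @small_right_mass a (dr / (s + 1)) (divr_gt0 dr0 s1).
  have [] := @ae_exists_itv _ a (Num.min b (Num.min (a + lam) c)) _ _ aeJ.
    by rewrite !lt_min ab ac ltrDl l0.
  move=> z /andP[az]; rewrite !lt_min => /and3P[zb zl zc'] zE.
  have fz0 : 0 < f z by rewrite fac// ltW.
  have [|_ gE] := sep z; first by apply: zE; rewrite /= in_itv/= ltW.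
  have {}gE : s * g z = g (z + lam) by apply: (mulfI _ gE); rewrite gt_eqF.
  set e := dr / (s + 1) in bd.
  have e0 : 0 < e by rewrite divr_gt0.
  have eE : e * (s + 1) = dr by rewrite mulfVK// gt_eqF.
  have gz : g z < e.
    rewrite -lte_fin (le_lt_trans _ bd)//.
    apply: (@le_trans _ _ (\int[mu]_(x in `]a, z]) (f x)%:E)%E).
      rewrite integral_itv_obnd_cbnd; last first.
        exact/measurable_funTS/measurable_EFinP.
      apply: window_le_mass => // x /W0 xz fx.
      by rewrite /= in_itv/= fa//= -subr_ge0.
    apply: ge0_subset_integral => //.
    - exact/measurable_funTS/measurable_EFinP.
    - by move=> x _; rewrite lee_fin.
    - move=> x; rewrite /= !in_itv/= => /andP[-> xz].
      by rewrite (le_trans xz)// ltW.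
  have gzl : dr <= g (z + lam).
    rewrite -lee_fin -drE; apply: window_ge_mass => // x.
    rewrite /D/= in_itv/= => /andP[ax xal].
    by apply: (Wdc _ _ Wt0); lra.
  have := ler_wpM2l s0 (ltW gz); lra.
(* Here the support has no left endpoint, so f is positive somewhere below every z. *)
have fl z : z <= c -> 0 < f z /\ 0 < g z.
  move=> zc'; have [y yz fy] : exists2 y, y < z & 0 < f y.
    apply: contrapT => ny; apply: nx0; exists z => y yz.
    apply/eqP; rewrite eq_le f0 andbT leNgt; apply/negP => fy.
    by apply: ny; exists y.
  have yc : y < c by exact: lt_le_trans zc'.
  split; first by apply: (MLR_support fy fc); rewrite (ltW yz).
  by apply: (window_support_gt0 fy fc yc yz); move: t0_gt0; lra.
have aeP : {ae mu, forall z, f (z + lam) = r * f z}.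
  apply: (ae_imply2 _ aeJ aeK) => z eJ eK.
  have [zc'|cz] := leP z c.
    have [|+ _] := sep z; first by apply: eJ; rewrite /= in_itv.
    have [fz0 gz0] := fl _ zc'.
    by move=> /(mulIf (lt0r_neq0 gz0)).
  have [|+ _] := sep z; first by rewrite eK// /= in_itv/= cz.
  (* To the right of c, f may vanish at z; MLR against c then makes f(z + lam) vanish too. *)
  have [fzE|fzN] := eqVneq (f z) 0.
    have := MLR_shift (ltW l0) (ltW cz); rewrite fzE !mulr0.
    by rewrite pmulr_lle0// => h _; apply/eqP; rewrite eq_le h f0.
  have fz0 : 0 < f z by rewrite lt_neqAle eq_sym fzN f0.
  have gz0 : 0 < g z.
    by apply: (window_support_gt0 fc fz0 cz cz); move: t0_gt0; lra.
  by move=> /(mulIf (lt0r_neq0 gz0)).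
(* Both sides of the almost everywhere identity are integrated over the line: f and its shift have
   mass 1. *)
have rE : r = 1.
  have : (\int[mu]_z (f (z + lam))%:E = \int[mu]_z (r * f z)%:E)%E.
    apply: ae_eq_integral => //.
    - exact: mefD.
    - by apply/measurable_EFinP; exact: measurable_funM.
    - by move: aeP; apply: ae_imply => z /= ->.
  have mF : measurable_fun [set: R] (EFin \o f) by exact/measurable_EFinP.
  have F0 x : (0 <= (EFin \o f) x)%E by rewrite lee_fin.
  rewrite (ge0_integral_translate lam mF F0) f1.
  under eq_integral do rewrite EFinM.
  rewrite ge0_integralZl//; last 2 first.
  - by move=> x _; rewrite lee_fin.
  - by rewrite lee_fin divr_ge0.
  by rewrite f1 mule1 => -[].
have := not_periodic_density l0 fc cw fw; apply.
by move: aeP; apply: ae_imply => z; rewrite rE mul1r.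
Qed.

End balance.
End convolution_window.

(** * Joint law of X_(2) - theta_(2) and U *)

Section gap_law.
Context (R : realType) (f : R -> R).
Hypotheses (mf : measurable_fun [set: R] f) (f0 : forall x, 0 <= f x)
  (f1 : (\int[@lebesgue_measure R]_x (f x)%:E = 1)%E).
Notation mu := (@lebesgue_measure R).

Lemma lebesgue_tonelli1 (h : R * R -> \bar R) :
  measurable_fun [set: R * R] h -> (forall z, (0 <= h z)%E) ->
  (\int[mu \x mu]_z h z = \int[mu]_x \int[mu]_y h (x, y))%E.
Proof. exact: (@fubini_tonelli1 _ _ _ _ R mu mu h). Qed.

Lemma lebesgue_tonelli2 (h : R * R -> \bar R) :
  measurable_fun [set: R * R] h -> (forall z, (0 <= h z)%E) ->
  (\int[mu \x mu]_z h z = \int[mu]_y \int[mu]_x h (x, y))%E.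
Proof. exact: (@fubini_tonelli2 _ _ _ _ R mu mu h). Qed.

(** Reflection turns the integral in y into a window at x - b, and the translation z = x - m centres
    the outer variable. *)
Let iterated_integral (D V : set R) (a b m : R) : measurable D -> measurable V ->
  (\int[mu]_x \int[mu]_y
     ((f (x - a) * f (y - b)) * (\1_D (x - m) * \1_V (x - y)))%:E =
   \int[mu]_(z in D) (f (z + (m - a)) * window f V (z + (m - b)))%:E)%E.
Proof.
move=> mD mV.
pose h x := (\1_D x * (f (x + (m - a)) * window f V (x + (m - b))))%:E.
have mh : measurable_fun [set: R] h.
  apply/measurable_EFinP; apply: measurable_funM; first exact: measurable_indic.
  apply: measurable_funM.
    by apply: measurableT_comp => //; exact: measurable_funD.
  apply: measurableT_comp; first exact: measurable_window.
  exact: measurable_funD.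
have h0 x : (0 <= h x)%E by rewrite lee_fin !mulr_ge0// window_ge0.
transitivity (\int[mu]_x h (x - m)%R)%E; last first.
  rewrite (ge0_integral_translate _ mh h0) [RHS]integral_mkcond.
  apply: eq_integral => x _; rewrite /h patchE indicE.
  by case: ifP; rewrite ?mul1r ?mul0r.
apply: eq_integral => x _.
have mI := measurable_reflect x mV.
transitivity (\int[mu]_(y in [set y | V (x - y)%R])
    ((f (x - a) * \1_D (x - m))%:E * (f (y - b))%:E))%E.
  rewrite [RHS]integral_mkcond; apply: eq_integral => y _.
  rewrite patchE.
  rewrite (_ : (y \in [set y | V (x - y)]) = (x - y \in V)); last first.
    by apply/idP/idP; rewrite !inE.
  rewrite !indicE; case: (x - y \in V); rewrite ?mulr1 ?mulr0//.
  by rewrite -EFinM; congr EFin; ring.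
rewrite ge0_integralZl//.
- rewrite -(@window_reflectE _ _ mf f0 _ x (- b))// -windowE//.
  rewrite -EFinM /h; congr EFin.
  rewrite (_ : x - m + (m - a) = x - a); last by ring.
  rewrite (_ : x - m + (m - b) = x - b); last by ring.
  by ring.
- apply/measurable_EFinP/measurable_funTS; apply: measurableT_comp => //.
  exact: measurable_funD.
- by move=> y _; rewrite lee_fin.
- by rewrite lee_fin mulr_ge0.
Qed.

(** A point is null. Dropping 0 from one window keeps ties X1 = X2 from being counted twice in
    [gap_law]. *)
Lemma window_setD0 (V : set R) (z : R) : measurable V ->
  window f (V `\ 0) z = window f V z.
Proof.
move=> mV; congr fine; rewrite [RHS](@ge0_negligible_integral _ _ _ mu V [set 0])//.
- apply/measurable_funTS/measurable_EFinP; apply: measurableT_comp => //.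
  exact: measurable_funB.
- by move=> x _; rewrite lee_fin.
- exact: lebesgue_measure_set1.
Qed.

Context d (T : measurableType d) (P : probability T R) (X1 X2 : {mfun T >-> R})
  (a b : R).
Hypotheses (ind : independent_RVs P X1 X2)
  (law1 : has_density P X1 (fun x => f (x - a)))
  (law2 : has_density P X2 (fun x => f (x - b))).

Let F (z : R * R) : \bar R := (f (z.1 - a) * f (z.2 - b))%:E.

Let mF : measurable_fun [set: R * R] F.
Proof.
apply/measurable_EFinP; apply: measurable_funM; apply: measurableT_comp => //;
  exact: measurable_funB.
Qed.

Let F0 z : (0 <= F z)%E. Proof. by rewrite lee_fin mulr_ge0. Qed.

Let mX12 : measurable_fun [set: T] (fun w => (X1 w, X2 w)).
Proof. exact: measurable_fun_pair. Qed.

(** By independence, the law of the pair agrees on rectangles with the product of the marginal laws,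
    and so does the measure with density F; uniqueness of the product measure identifies them. *)
Lemma joint_law (S : set (R * R)) : measurable S ->
  (P [set w | S (X1 w, X2 w)] = \int[mu \x mu]_(z in S) F z)%E.
Proof.
move=> mS.
(* [idM] is the identity; pushing forward along it moves the density measure to the measurable type
   of the observations. *)
pose idM (z : measurableTypeR R * measurableTypeR R) : R * R := (z.1, z.2).
have mid : measurable_fun setT idM.
  by apply: measurable_fun_pair; [exact: measurable_fst|exact: measurable_snd].
pose nu' : {measure set (R * R) -> \bar R} := @pushforward _ _ _ _ R
  (density_measure (mu \x mu)%E mF F0) idM.
pose nu := nu' mid.
transitivity ((distribution P X1 \x distribution P X2)%E S).
  apply/esym/(product_measure_unique
    (m' := pushforward P (fun w => (X1 w, X2 w)))) => //.
have -> : (\int[mu \x mu]_(z in S) F z)%E = nu S.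
  rewrite /nu /nu' /pushforward /density_measure; congr integral.
  by apply/seteqP; split => -[].
apply: (@product_measure_unique _ _ R R R
  (distribution P X1) (distribution P X2) nu) => // A B mA mB.
have [mA' mB'] : measurable (A : set R) /\ measurable (B : set R) by [].
pose h1 x := (f (x - a) * \1_A x)%:E; pose h2 y := (f (y - b) * \1_B y)%:E.
have mh1 : measurable_fun [set: R] h1.
  apply/measurable_EFinP; apply: measurable_funM; last exact: measurable_indic.
  by apply: measurableT_comp => //; exact: measurable_funB.
have mh2 : measurable_fun [set: R] h2.
  apply/measurable_EFinP; apply: measurable_funM; last exact: measurable_indic.
  by apply: measurableT_comp => //; exact: measurable_funB.
have h1_ge0 x : (0 <= h1 x)%E by rewrite lee_fin mulr_ge0.
have h2_ge0 y : (0 <= h2 y)%E by rewrite lee_fin mulr_ge0.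
transitivity (\int[mu \x mu]_z (h1 z.1 * h2 z.2))%E.
  transitivity (\int[mu \x mu]_(z in idM @^-1` (A `*` B)) F z)%E; first by [].
  rewrite integral_mkcond; apply: eq_integral => -[x y] _.
  rewrite patchE /F/= /h1 /h2 -EFinM !indicE.
  rewrite (_ : ((x, y) \in _) = (x \in A) && (y \in B)); last first.
    apply/idP/idP => [|/andP[]]; rewrite !inE => // -[? ?].
    by apply/andP; rewrite !inE.
  by case: (x \in A); case: (y \in B); rewrite /= ?mulr1 ?mulr0 ?mul0r.
have mh12 : measurable_fun [set: R * R] (fun z : R * R => h1 z.1 * h2 z.2)%E.
  apply: emeasurable_funM.
    exact: (measurableT_comp mh1 measurable_fst).
  exact: (measurableT_comp mh2 measurable_snd).
rewrite (lebesgue_tonelli1 mh12)/=; last by move=> z; exact: mule_ge0.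
transitivity (\int[mu]_x (h1 x * \int[mu]_y h2 y))%E.
  by apply: eq_integral => x _; rewrite ge0_integralZl.
rewrite ge0_integralZr//; last exact: integral_ge0.
rewrite (law1 mA) (law2 mB) [RHS]/=; congr (_ * _)%E.
  rewrite [RHS]integral_mkcond; apply: eq_integral => x _.
  by rewrite /h1 patchE indicE; case: ifP; rewrite ?mulr1 ?mulr0.
rewrite [RHS]integral_mkcond; apply: eq_integral => x _.
by rewrite /h2 patchE indicE; case: ifP; rewrite ?mulr1 ?mulr0.
Qed.

(** The event splits according to which observation is the larger: [S1] has X2 <= X1 and [S2] has X1
    < X2. Each half yields one of the two terms of [gap_density]. *)
Lemma gap_law (D W : set R) : measurable D -> measurable W ->
  (forall u, W u -> 0 <= u) ->
  let m := Num.max a b in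
  (P [set w | D (Num.max (X1 w) (X2 w) - m)%R /\
              W (Num.max (X1 w) (X2 w) - Num.min (X1 w) (X2 w))%R] =
   \int[mu]_(z in D) (gap_density f W `|a - b| z)%:E)%E.
Proof.
move=> mD mW W0 m.
pose S1 := [set z : R * R | D (z.1 - m) /\ W (z.1 - z.2)].
pose S2 := [set z : R * R | D (z.2 - m) /\ (W `\ 0) (z.2 - z.1)].
have mW' : measurable (W `\ 0) by apply: measurableD => //; exact: measurable_set1.
have mS1 : measurable S1.
  have m1 : measurable_fun [set: R * R] (fun z : R * R => z.1 - m).
    exact: measurable_funB.
  have m2 : measurable_fun [set: R * R] (fun z : R * R => z.1 - z.2).
    exact: measurable_funB.
  have := m1 measurableT _ mD; have := m2 measurableT _ mW.
  by rewrite !setTI => ? ?; exact: measurableI.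
have mS2 : measurable S2.
  have m1 : measurable_fun [set: R * R] (fun z : R * R => z.2 - m).
    exact: measurable_funB.
  have m2 : measurable_fun [set: R * R] (fun z : R * R => z.2 - z.1).
    exact: measurable_funB.
  have := m1 measurableT _ mD; have := m2 measurableT _ mW'.
  by rewrite !setTI => ? ?; exact: measurableI.
rewrite (_ : [set w | _] = [set w | (S1 `|` S2) (X1 w, X2 w)]); last first.
  apply/seteqP; split => w /=.
    have [x12|x21] := ltP (X1 w) (X2 w) => -[Dw Ww].
      by right; split => //; split=> //=; apply/eqP; rewrite subr_eq0 gt_eqF.
    by left.
  move=> [[Dw Ww]|[Dw [Ww /= /eqP]]].
    have := W0 _ Ww; rewrite /= subr_ge0 => x21.
    by rewrite max_l// min_r.
  have := W0 _ Ww; rewrite /= subr_ge0 => x12 _.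
  by rewrite max_r// min_l.
have S12 : [disjoint S1 & S2].
  rewrite disj_set2E; apply/eqP; rewrite -subset0 => z [[_ Wz] [_ [Wz' /=]]].
  have := W0 _ Wz; have := W0 _ Wz'; rewrite !subr_ge0 => z1 z2 [].
  by apply/eqP; rewrite subr_eq0 eq_le z1 z2.
rewrite joint_law; last exact: measurableU.
rewrite ge0_integral_setU//; last exact: measurable_funTS.
have mFS (S : set (R * R)) : measurable S -> measurable_fun [set: R * R] (F \_ S).
  by move=> mS; apply/(measurable_restrictT _ mS); exact: measurable_funTS.
have FS0 (S : set (R * R)) z : (0 <= (F \_ S) z)%E by exact: erestrict_ge0.
have -> : (\int[mu \x mu]_(z in S1) F z =
    \int[mu]_(z in D) (f (z + (m - a)) * window f W (z + (m - b)))%:E)%E.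
  rewrite integral_mkcond (lebesgue_tonelli1 (mFS _ mS1) (FS0 S1)).
  rewrite -(iterated_integral _ _ _ mD mW).
  apply: eq_integral => x _; apply: eq_integral => y _.
  rewrite patchE /F/= !indicE.
  rewrite (_ : ((x, y) \in S1) = (x - m \in D) && (x - y \in W)); last first.
    apply/idP/idP => [|/andP[]]; rewrite !inE => // -[? ?].
    by apply/andP; rewrite !inE.
  by case: (x - m \in D); case: (x - y \in W); rewrite /= ?mulr1 ?mulr0 ?mul0r.
(* On [S2] the second coordinate is the maximum, so the order of integration is exchanged. *)
have -> : (\int[mu \x mu]_(z in S2) F z =
    \int[mu]_(z in D) (f (z + (m - b)) * window f W (z + (m - a)))%:E)%E.
  rewrite integral_mkcond (lebesgue_tonelli2 (mFS _ mS2) (FS0 S2)).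
  under [RHS]eq_integral do rewrite -window_setD0//.
  rewrite -(iterated_integral _ _ _ mD mW').
  apply: eq_integral => y _; apply: eq_integral => x _.
  rewrite patchE /F/= !indicE [f (y - b) * _]mulrC.
  rewrite (_ : ((x, y) \in S2) = (y - m \in D) && (y - x \in W `\ 0)); last first.
    apply/idP/idP => [|/andP[]]; rewrite !inE => // -[? ?].
    by apply/andP; rewrite !inE.
  by case: (y - m \in D); case: (y - x \in W `\ 0);
    rewrite /= ?mulr1 ?mulr0 ?mul0r.
have mfw (p q : R) : measurable_fun [set: R]
    (fun z => (f (z + p) * window f W (z + q))%:E).
  apply/measurable_EFinP; apply: measurable_funM.
    by apply: measurableT_comp => //; exact: measurable_funD.
  apply: measurableT_comp; first exact: measurable_window.
  exact: measurable_funD.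
have fw0 (p q z : R) : (0 <= (f (z + p) * window f W (z + q))%:E)%E.
  by rewrite lee_fin mulr_ge0// window_ge0.
rewrite -(ge0_integralD mu mD (fun z _ => fw0 (m - a) (m - b) z)
  (measurable_funTS (mfw _ _)) (fun z _ => fw0 (m - b) (m - a) z)
  (measurable_funTS (mfw _ _))).
(* One of the shifts m - a and m - b is 0 and the other is |a - b|. *)
apply: eq_integral => z _; rewrite -EFinD; congr EFin; rewrite /gap_density /m.
have [ab|/ltW ba] := leP a b.
  by rewrite ler0_norm ?subr_le0// opprB subrr addr0.
by rewrite ger0_norm ?subr_ge0// subrr addr0 addrC.
Qed.

End gap_law.

(** * The difference of two risks as an integral over thresholds c *)

Section risk_comparison.
Context d (T : measurableType d) (R : realType) (P : probability T R).
Variables (Y Z : T -> R) (b : R).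
Hypotheses (mY : measurable_fun [set: T] Y) (mZ : measurable_fun [set: T] Z)
  (Yb : forall w, Y w <= b).
Notation mu := (@lebesgue_measure R).
Local Open Scope ereal_scope.

(** In the application Y is phi(U) and Z is X_(2) - theta_(2). The condition c < b is part of the
    events so that c can range over the whole line. *)
Let below (c : R) := [set w | Y w < c /\ c < b /\ Z w <= c]%R.
Let above (c : R) := [set w | Y w < c /\ c < b /\ c < Z w]%R.

(* d/dc |Z - c| is +1 where Z <= c and -1 where c < Z; integrate from Y to b. *)
Lemma dist_exchange (y z : R) : (y <= b)%R ->
  `|z - b|%:E + mu [set c | y < c /\ c < b /\ c < z]%R =
  `|z - y|%:E + mu [set c | y < c /\ c < b /\ z <= c]%R.
Proof.
move=> yb.
have -> : [set c | y < c /\ c < b /\ c < z]%R = `]y, (Num.min b z)[%classic.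
  apply/seteqP; split => c /=; rewrite in_itv/= lt_min.
    by move=> [-> [-> ->]].
  by move=> /and3P[-> -> ->].
rewrite lebesgue_measure_itv/= lte_fin lt_min.
have [zy|yz] := leP z y.
  have -> : [set c | y < c /\ c < b /\ z <= c]%R = `]y, b[%classic.
    apply/seteqP; split => c /=; rewrite in_itv/=; first by move=> [-> [-> _]].
    by move=> /andP[yc ->]; rewrite yc (le_trans zy) ?ltW.
  rewrite lebesgue_measure_itv/= lte_fin andbF adde0.
  rewrite !ler0_norm ?subr_le0 ?(le_trans zy)//.
  have [yb'|by'] := ltP y b; first by rewrite -!EFinD; congr EFin; ring.
  by rewrite adde0 (@le_anti _ _ y b)// yb by'.
have -> : [set c | y < c /\ c < b /\ z <= c]%R = `[z, b[%classic.
  apply/seteqP; split => c /=; rewrite in_itv/=; first by move=> [_ [-> ->]].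
  by move=> /andP[zc ->]; rewrite zc (lt_le_trans yz).
rewrite lebesgue_measure_itv/= lte_fin andbT.
rewrite [`|z - y|%R]ger0_norm ?subr_ge0 ?(ltW yz)//.
have [zb|bz] := ltP z b.
  rewrite (lt_trans yz zb) ler0_norm ?subr_le0 ?(ltW zb)//.
  by rewrite -!EFinD; congr EFin; ring.
rewrite ger0_norm ?subr_ge0//.
move: yb; rewrite le_eqVlt => /predU1P[->|yb]; first by rewrite ltxx.
by rewrite yb adde0 -!EFinD; congr EFin; ring.
Qed.

Let mabs c : measurable_fun [set: T] (fun w => `|Z w - Y w|%:E) /\
  measurable_fun [set: T] (fun w => `|Z w - c|%:E).
Proof.
by split; apply/measurable_EFinP; apply: measurableT_comp => //;
  exact: measurable_funB.
Qed.

Let mltr (U V : T * R -> R) : measurable_fun [set: T * R] U ->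
  measurable_fun [set: T * R] V -> measurable [set z | U z < V z]%R.
Proof.
by move=> mU mV; rewrite -[X in measurable X]setTI; exact: measurable_fun_ltr.
Qed.

Let mler (U V : T * R -> R) : measurable_fun [set: T * R] U ->
  measurable_fun [set: T * R] V -> measurable [set z | U z <= V z]%R.
Proof.
by move=> mU mV; rewrite -[X in measurable X]setTI; exact: measurable_fun_ler.
Qed.

Let mY1 : measurable_fun [set: T * R] (fun z => Y z.1).
Proof. exact: (measurableT_comp mY measurable_fst). Qed.

Let mZ1 : measurable_fun [set: T * R] (fun z => Z z.1).
Proof. exact: (measurableT_comp mZ measurable_fst). Qed.

Let m2 : measurable_fun [set: T * R] (fun z => z.2).
Proof. exact: measurable_snd. Qed.

Let mabove : measurable [set z : T * R | above z.2 z.1].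
Proof.
apply: measurableI; first exact: (mltr mY1 m2).
apply: measurableI; first exact: (mltr m2 (measurable_cst _)).
exact: (mltr m2 mZ1).
Qed.

Let mbelow : measurable [set z : T * R | below z.2 z.1].
Proof.
apply: measurableI; first exact: (mltr mY1 m2).
apply: measurableI; first exact: (mltr m2 (measurable_cst _)).
exact: (mler mZ1 m2).
Qed.

Let section_tonelli (S : set (T * R)) : measurable S ->
  [/\ measurable_fun [set: T] (fun w => mu [set c | S (w, c)]),
    measurable_fun [set: R] (fun c => P [set w | S (w, c)]),
    forall w, measurable [set c | S (w, c)],
    forall c, measurable [set w | S (w, c)] &
    \int[P]_w mu [set c | S (w, c)] = \int[mu]_c P [set w | S (w, c)]].
Proof.
move=> mS.
have mS2 w : measurable [set c | S (w, c)].
  by have := measurable_xsection w mS; rewrite xsectionE.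
have mS1 c : measurable [set w | S (w, c)].
  by have := measurable_ysection c mS; rewrite ysectionE.
pose h (z : T * R) : \bar R := (\1_S z)%:E.
have mh : measurable_fun [set: T * R] h.
  by apply/measurable_EFinP; exact: measurable_indic.
have h0 z : 0 <= h z by rewrite lee_fin.
have FE w : \int[mu]_c h (w, c) = mu [set c | S (w, c)].
  rewrite -[[set c | S (w, c)]]setIT -integral_indic//.
  exact: mS2.
have GE c : \int[P]_w h (w, c) = P [set w | S (w, c)].
  by rewrite -[[set w | S (w, c)]]setIT -integral_indic.
split => //.
- under eq_fun do rewrite -FE.
  exact: (@measurable_fun_fubini_tonelli_F _ _ _ _ R mu h).
- under eq_fun do rewrite -GE.
  exact: (@measurable_fun_fubini_tonelli_G _ _ _ _ R P h).
under eq_integral do rewrite -FE.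
under [RHS]eq_integral do rewrite -GE.
exact: (@fubini_tonelli _ _ _ _ R P mu h).
Qed.

(** Tonelli integrates [dist_exchange] over the sample space. With sums on both sides, no finiteness
    is required. *)
Lemma risk_exchange :
  \int[P]_w `|Z w - b|%:E + \int[mu]_c P (above c) =
  \int[P]_w `|Z w - Y w|%:E + \int[mu]_c P (below c).
Proof.
have [mA _ _ _ <-] := section_tonelli mabove.
have [mB _ _ _ <-] := section_tonelli mbelow.
rewrite -!ge0_integralD//.
- by apply: eq_integral => w _; exact: (dist_exchange (Z w) (Yb w)).
- by case: (mabs b).
- by case: (mabs b).
Qed.

Hypotheses (Pab : forall c, (c < b)%R -> P (above c) <= P (below c))
  (Yfin : \int[P]_w `|Z w - Y w|%:E < +oo)
  (bfin : \int[P]_w `|Z w - b|%:E < +oo).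

Let ab c : P (above c) <= P (below c).
Proof.
have [/Pab//|bc] := ltP c b.
rewrite (_ : above c = set0) ?measure0//.
by rewrite -subset0 => w [_ [+ _]]; rewrite ltNge bc.
Qed.

(** For fixed w the thresholds lie in ]Y w, Z w[, whose length is at most |Z w - Y w|. *)
Let above_lty : \int[mu]_c P (above c) < +oo.
Proof.
have [mA _ mAs _ <-] := section_tonelli mabove.
apply: le_lt_trans Yfin; apply: ge0_le_integral => //; first by case: (mabs b).
move=> w _; apply: (@le_trans _ _ (mu `]Y w, (Z w)[%classic)).
  apply: le_measure; [apply/mem_set; exact: mAs|apply/mem_set => //|].
  by move=> c [Yc [_ cZ]]; rewrite /= in_itv/= Yc.
rewrite lebesgue_measure_itv/= lte_fin; case: ifPn => [yz|_]; last by rewrite lee_fin.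
by rewrite -EFinD lee_fin ler_norm.
Qed.

Let above_le_below : \int[mu]_c P (above c) <= \int[mu]_c P (below c).
Proof.
have [_ mA _ _ _] := section_tonelli mabove.
have [_ mB _ _ _] := section_tonelli mbelow.
by apply: ge0_le_integral.
Qed.

Let below_lty : \int[mu]_c P (below c) < +oo.
Proof.
rewrite (@le_lt_trans _ _ (\int[P]_w `|Z w - Y w|%:E + \int[mu]_c P (below c)))//.
  by rewrite leeDr// integral_ge0.
by rewrite -risk_exchange lte_add_pinfty.
Qed.

Lemma risk_le : \int[P]_w `|Z w - Y w|%:E <= \int[P]_w `|Z w - b|%:E.
Proof.
have := risk_exchange; move: Yfin bfin below_lty above_lty above_le_below.
have i1 : 0 <= \int[P]_w `|Z w - Y w|%:E by exact: integral_ge0.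
have i2 : 0 <= \int[P]_w `|Z w - b|%:E by exact: integral_ge0.
have i3 : 0 <= \int[mu]_c P (below c) by exact: integral_ge0.
have i4 : 0 <= \int[mu]_c P (above c) by exact: integral_ge0.
move: i1 i2 i3 i4.
case: (\int[P]_w _) => [r1| |]//; case: (\int[P]_w _) => [r2| |]//.
case: (\int[mu]_c _) => [r3| |]//; case: (\int[mu]_c _) => [r4| |]//.
move=> _ _ _ _ _ _ _ _; rewrite -!EFinD !lee_fin => r34 [r]; lra.
Qed.

(** If the integrals over c were equal, the two probabilities would agree for almost every c, hence
    at some c in ]p, b[. Finiteness of all four terms then allows subtraction in [risk_exchange]. *)
Lemma risk_lt (p : R) : (p < b)%R ->
  (forall c, (p < c < b)%R -> P (above c) < P (below c)) ->
  \int[P]_w `|Z w - Y w|%:E < \int[P]_w `|Z w - b|%:E.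
Proof.
move=> pb lt_ab.
have [_ mA _ mAc _] := section_tonelli mabove.
have [_ mB _ mBc _] := section_tonelli mbelow.
have aE c : P (above c) = (fine (P (above c)))%:E.
  by rewrite fineK// fin_num_measure//; exact: mAc.
have bE c : P (below c) = (fine (P (below c)))%:E.
  by rewrite fineK// fin_num_measure//; exact: mBc.
have lt_int : \int[mu]_c P (above c) < \int[mu]_c P (below c).
  rewrite ltNge; apply/negP => ba.
  pose u c := fine (P (above c)); pose v c := fine (P (below c)).
  have aev : {ae mu, forall c, [set: R] c -> u c = v c}.
    apply: (@ae_eq_of_le_integral _ _ _ mu [set: R] u v).
    - exact: measurableT.
    - exact: (measurableT_comp _ mA).
    - exact: (measurableT_comp _ mB).
    - move=> c _; rewrite /u /v fine_ge0 ?measure_ge0//=.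
      by rewrite -lee_fin -aE -bE; exact: ab.
    - by under eq_integral do rewrite -aE.
    - under eq_integral do rewrite -bE.
      by under [leRHS]eq_integral do rewrite -aE.
  have [c pcb /(_ I) uv] := ae_exists_itv pb aev.
  by have := lt_ab c pcb; rewrite aE bE -/(u c) -/(v c) uv ltxx.
have := risk_exchange; move: Yfin bfin below_lty above_lty lt_int.
have i1 : 0 <= \int[P]_w `|Z w - Y w|%:E by exact: integral_ge0.
have i2 : 0 <= \int[P]_w `|Z w - b|%:E by exact: integral_ge0.
have i3 : 0 <= \int[mu]_c P (below c) by exact: integral_ge0.
have i4 : 0 <= \int[mu]_c P (above c) by exact: integral_ge0.
move: i1 i2 i3 i4.
case: (\int[P]_w _) => [r1| |]//; case: (\int[P]_w _) => [r2| |]//.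
case: (\int[mu]_c _) => [r3| |]//; case: (\int[mu]_c _) => [r4| |]//.
move=> _ _ _ _ _ _ _ _; rewrite -!EFinD lte_fin lte_fin => r34 [r]; lra.
Qed.

End risk_comparison.

(** * The integral condition on phi as balance at lam = 0 *)

Section balanced_windows.
Context (R : realType) (f : R -> R).
Hypotheses (mf : measurable_fun [set: R] f) (f0 : forall x, 0 <= f x)
  (f1 : (\int[@lebesgue_measure R]_x (f x)%:E = 1)%E).
Notation mu := (@lebesgue_measure R).

(** The inner integral is f(z) G(z), half the gap density at lam = 0. Having at least half the total
    mass up to s means balance at s, and raising s to c moves mass only from right to left. *)
Lemma balanced_interval (t s c : R) : s <= c ->
  ((2^-1)%:E * \int[mu]_z \int[mu]_(u in `[0%R, t]) (f (z - u) * f z)%:E <=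
   \int[mu]_(z in `]-oo, s]) \int[mu]_(u in `[0%R, t]) (f (z - u) * f z)%:E)%E ->
  (\int[mu]_(z in `]c, +oo[) (gap_density f `[0%R, t] 0 z)%:E <=
   \int[mu]_(z in `]-oo, c]) (gap_density f `[0%R, t] 0 z)%:E)%E.
Proof.
move=> sc.
have mW : measurable (`[0, t]%classic : set R) by exact: measurable_itv.
pose h z := gap_density f `[0, t] 0 z.
have mh (D : set R) : measurable_fun D (fun z => (h z)%:E).
  apply/measurable_funTS/measurable_EFinP; exact: measurable_gap_density.
have h0 z : (0 <= (h z)%:E)%E by rewrite lee_fin gap_density_ge0.
have inner z : (\int[mu]_(u in `[0%R, t]) (f (z - u) * f z)%:E =
    (2^-1)%:E * (h z)%:E)%E.
  under eq_integral do rewrite EFinM.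
  rewrite ge0_integralZr//; last 3 first.
  - apply/measurable_funTS/measurable_EFinP; apply: measurableT_comp => //.
    exact: measurable_funB.
  - by move=> u _; rewrite lee_fin.
  - by rewrite lee_fin.
  rewrite -(windowE mf f0 f1)// /h /gap_density !addr0 -!EFinM.
  by congr EFin; field.
under eq_integral do rewrite inner.
under [leRHS]eq_integral do rewrite inner.
have ZE (D : set R) : measurable D ->
    (\int[mu]_(z in D) ((2^-1)%:E * (h z)%:E) =
     (2^-1)%:E * \int[mu]_(z in D) (h z)%:E)%E.
  by move=> mD; apply: ge0_integralZl => //; exact: mh.
rewrite !ZE//.
have mJ (x : R) : measurable (`]-oo, x]%classic : set R) by exact: measurable_itv.
have setTD x : [set: R] `\` `]-oo, x] = `]x, +oo[%classic.
  by rewrite setTD -[RHS]setCK setCitvr.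
have TE x : (\int[mu]_z (h z)%:E =
    \int[mu]_(z in `]x, +oo[) (h z)%:E + \int[mu]_(z in `]-oo, x]) (h z)%:E)%E.
  rewrite -setTD -[in X in (_ + X)%E](setTI `]-oo, x]%classic).
  exact: (ge0_integral_setID mu measurableT (mJ x) (mh _) h0).
have fin (D : set R) : measurable D ->
    exists r, (\int[mu]_(z in D) (h z)%:E = r%:E)%E.
  move=> mD; eexists; symmetry; apply: fineK.
  rewrite ge0_fin_numE; last by apply: integral_ge0.
  exact: (gap_density_lty mf f0 f1).
have mKc : measurable (`]c, +oo[%classic : set R) by exact: measurable_itv.
have mKs : measurable (`]s, +oo[%classic : set R) by exact: measurable_itv.
have : (\int[mu]_(z in `]-oo, s]) (h z)%:E <=
    \int[mu]_(z in `]-oo, c]) (h z)%:E)%E.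
  apply: ge0_subset_integral => //; first exact: mh.
  by move=> z; rewrite /= !in_itv/= => /le_trans; exact.
have : (\int[mu]_z (h z)%:E = \int[mu]_z (h z)%:E)%E by [].
rewrite {1}(TE s) (TE c).
have [ks ->] := fin _ mKs; have [kc ->] := fin _ mKc.
have [js ->] := fin _ (mJ s); have [jc ->] := fin _ (mJ c).
by rewrite -!EFinD -!EFinM !lee_fin => -[E1] jsc h1; lra.
Qed.

End balanced_windows.

(** * Sublevel sets of phi and their exhaustion by intervals *)

Section sublevel_windows.
Context (R : realType) (phi : R -> R).
Hypothesis phi_incr : forall s t : R, 0 <= s -> s <= t -> phi s <= phi t.

Definition sublevel_window (c : R) : set R := [set s | 0 <= s /\ phi s < c].

(** Composition with [Num.max 0] extends the monotonicity of phi from the nonnegative reals to the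
    line. *)
Lemma measurable_phi_ge0 :
  measurable_fun [set: R] (fun s => phi (Num.max 0 s)).
Proof.
apply: nondecreasing_measurable => // s t st; apply: phi_incr.
  by rewrite le_max lexx.
by rewrite ge_max !le_max lexx st orbT.
Qed.

Lemma measurable_sublevel_window c : measurable (sublevel_window c).
Proof.
have -> : sublevel_window c =
    `[0, +oo[%classic `&` (fun s => phi (Num.max 0 s)) @^-1` `]-oo, c[%classic.
  apply/seteqP; split => s; rewrite /= !in_itv/= andbT => -[s0];
    by rewrite max_r.
apply: measurableI; first exact: measurable_itv.
by rewrite -[X in measurable X]setTI; apply: measurable_phi_ge0.
Qed.

Lemma sublevel_window_down c u v :
  0 <= u -> u <= v -> sublevel_window c v -> sublevel_window c u.
Proof.
by move=> u0 uv [v0 vc]; split => //; rewrite (le_lt_trans _ vc)// phi_incr.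
Qed.

(** The condition on phi concerns intervals [0, t] only; this exhaustion lets balance pass from them
    to a sublevel window, whether or not it contains its supremum. *)
Lemma sublevel_window_exhaust c t0 M : 0 < t0 -> sublevel_window c t0 ->
  (forall s, sublevel_window c s -> s <= M) ->
  exists t : nat -> R, [/\ forall n, sublevel_window c (t n),
    {homo t : m n / (m <= n)%N >-> m <= n} &
    sublevel_window c = \bigcup_n `[0, t n]%classic].
Proof.
move=> t00 Wt0 WM; set W := sublevel_window c.
have supW : has_sup W by split; [exists t0|exists M => s; exact: WM].
pose S := sup W.
have SW s : W s -> s <= S by move=> Ws; apply: ub_le_sup => //; exact: supW.2.
have unionW (t : nat -> R) : (forall n, W (t n)) ->
    (forall s, W s -> exists n, s <= t n) -> W = \bigcup_n `[0, t n]%classic.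
  move=> Wt tW; apply/seteqP; split => s.
    move=> Ws; have [n sn] := tW s Ws; exists n => //=.
    by rewrite in_itv/= sn andbT; case: Ws.
  move=> [n _ /=]; rewrite in_itv/= => /andP[s0 sn].
  exact: (sublevel_window_down s0 sn (Wt n)).
have [WS|nWS] := pselect (W S).
  exists (fun=> S); split => //; apply: unionW => // s /SW sS.
  by exists 0%N.
(* The sequence starts at t0 and increases to the unattained supremum S, remaining inside the
   window. *)
pose t n := S - (S - t0) / n.+1%:R.
have t0S : t0 < S.
  rewrite lt_neqAle SW// andbT; apply/eqP => E.
  by apply: nWS; rewrite -E.
have n0 n : 0 < n.+1%:R :> R by rewrite ltr0n.
have Wt n : W (t n).
  have e0 : 0 < (S - t0) / n.+1%:R by rewrite divr_gt0// subr_gt0.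
  have [w Ww wt] := sup_adherent e0 supW.
  apply: (sublevel_window_down _ (ltW wt) Ww).
  rewrite (le_trans (ltW t00))// lerBrDr -lerBrDl ler_pdivrMr//.
  by rewrite ler_peMr ?subr_ge0 ?(ltW t0S)// ler1n.
exists t; split => //.
  move=> m n mn; rewrite lerB// ler_wpM2l ?subr_ge0 ?(ltW t0S)//.
  by rewrite lef_pV2 ?posrE// ler_nat.
apply: unionW => // s Ws.
have sS : s < S.
  by rewrite lt_neqAle SW// andbT; apply/eqP => E; apply: nWS; rewrite -E.
have : 0 < (S - s) / (S - t0) by rewrite divr_gt0// subr_gt0.
move=> /ltr_add_invr[n]; rewrite add0r => /ltW h; exists n.
rewrite lerBrDr -lerBrDl.
have := ler_wpM2l (_ : 0 <= S - t0) h; rewrite subr_ge0 => /(_ (ltW t0S)).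
by rewrite mulrCA divff ?mulr1// gt_eqF// subr_gt0.
Qed.

End sublevel_windows.

(** * Domination, from balanced windows to the comparison of risks *)

Theorem theorem3p6 (R : realType) (d : measure_display) (T : measurableType d)
  (f : R -> R) (P : R * R -> probability T R) (X1 X2 : {mfun T >-> R})
  (phi : R -> R) (b0 c0 : R)
  (hf : prob_density f)
  (hmodel : location_model f P X1 X2)
  (hfin_phi : forall theta : R * R,
     (risk P X1 X2 (equivariant_estimator phi) theta < +oo)%E)
  (hfin_b0 : forall theta : R * R,
     (risk P X1 X2 (equivariant_estimator (fun=> b0)) theta < +oo)%E)
  (hMLR : MLR f)
  (hc0 : dist_fun f c0 = 2^-1)
  (hphi_incr : forall s t : R, 0 <= s -> s <= t -> phi s <= phi t)
  (hphi_nontrivial : exists2 t : R, 0 < t & phi t != b0)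
  (hphi_lim : phi t @[t --> +oo] --> b0)
  (hb0 : 2 * (\int[lebesgue_measure]_(x in `]-oo, b0]) (f x * dist_fun f x))
         = 2^-1)
  (hphi_ineq : forall t : R, 0 <= t ->
     ((2^-1)%R%:E *
        \int[lebesgue_measure]_z
          \int[lebesgue_measure]_(u in `[0%R, t]) (f (z - u) * f z)%R%:E
      <= \int[lebesgue_measure]_(z in `]-oo, phi t])
           \int[lebesgue_measure]_(u in `[0%R, t]) (f (z - u) * f z)%R%:E)%E) :
  improves_upon P X1 X2 (equivariant_estimator phi)
    (equivariant_estimator (fun=> b0)).
Proof.
case: hf => mf f0 f1.
have near_b0 e : 0 < e -> exists M, forall t, M < t -> `|b0 - phi t| < e.
  move=> e0; have /cvgrPdist_lt/(_ _ e0)[M [_ h]] := hphi_lim.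
  by exists M.
have phi_le s : 0 <= s -> phi s <= b0.
  move=> s0; rewrite leNgt; apply/negP => bs.
  have e0 : 0 < phi s - b0 by rewrite subr_gt0.
  have [M h] := near_b0 _ e0.
  have := h (Num.max s (M + 1)); rewrite lt_max ltrDl ltr01 orbT => /(_ isT).
  have := hphi_incr s (Num.max s (M + 1)) s0; rewrite le_max lexx => /(_ isT).
  by move=> h1; rewrite ltr_norml => /andP[]; lra.
pose W := sublevel_window phi.
have mW c : measurable (W c) by exact: measurable_sublevel_window.
have W0 c u : W c u -> 0 <= u by case.
have Wdc c u v : 0 <= u -> u <= v -> W c v -> W c u.
  exact: sublevel_window_down.
have W_bounded c : c < b0 -> exists M, forall s, W c s -> s <= M.
  move=> cb; have e0 : 0 < b0 - c by rewrite subr_gt0.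
  have [M h] := near_b0 _ e0.
  exists M => s [s0 sc]; rewrite leNgt; apply/negP => /h.
  by rewrite ltr_norml => /andP[]; lra.
pose U w := Num.max (X1 w) (X2 w) - Num.min (X1 w) (X2 w).
have U0 w : 0 <= U w by rewrite subr_ge0 ge_min le_max lexx.
pose Z (theta : R * R) w := Num.max (X1 w) (X2 w) - Num.max theta.1 theta.2.
have mX : measurable_fun [set: T] (fun w => Num.max (X1 w) (X2 w)).
  exact: measurable_maxr.
have mZ theta : measurable_fun [set: T] (Z theta) by exact: measurable_funB.
have mU : measurable_fun [set: T] U.
  by apply: measurable_funB => //; exact: measurable_minr.
have law theta (D V : set R) : measurable D -> measurable V ->
    (forall u, V u -> 0 <= u) ->
    (P theta [set w | D (Z theta w) /\ V (U w)] =
     \int[lebesgue_measure]_(z in D)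
       (gap_density f V `|theta.1 - theta.2| z)%:E)%E.
  move=> mD mV V0; have [ind law1 law2] := hmodel theta.
  exact: (gap_law mf f0 f1 ind law1 law2 mD mV V0).
have mJ (c : R) : measurable (`]-oo, c]%classic : set R) by exact: measurable_itv.
have mK (c : R) : measurable (`]c, +oo[%classic : set R) by exact: measurable_itv.
have base c t0 : c < b0 -> 0 < t0 -> W c t0 ->
    (\int[lebesgue_measure]_(z in `]c, +oo[) (gap_density f (W c) 0 z)%:E <=
     \int[lebesgue_measure]_(z in `]-oo, c]) (gap_density f (W c) 0 z)%:E)%E.
  move=> cb t00 Wt0; have [M WM] := W_bounded c cb.
  have [t [Wt ndt WE]] := sublevel_window_exhaust hphi_incr t00 Wt0 WM.
  (* At theta = (0, 0) the integrals are probabilities, so continuity from below along the windows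
     [0, t n] gives the limit. *)
  pose o : R * R := (0, 0).
  have law0 (D V : set R) : measurable D -> measurable V ->
      (forall u, V u -> 0 <= u) ->
      (P o [set w | D (Z o w) /\ V (U w)] =
       \int[lebesgue_measure]_(z in D) (gap_density f V 0 z)%:E)%E.
    by move=> mD mV V0; rewrite (law o D V mD mV V0)/= subrr normr0.
  rewrite -(law0 _ _ (mK c) (mW c) (@W0 c)) -(law0 _ _ (mJ c) (mW c) (@W0 c)).
  have mt n : measurable (`[0, t n]%classic : set R) by exact: measurable_itv.
  have t_ge0 n u : `[0, t n]%classic u -> 0 <= u.
    by rewrite /= in_itv/= => /andP[].
  pose F (D : set R) n := [set w | D (Z o w) /\ `[0, t n]%classic (U w)].
  have Fcvg (D : set R) : measurable D ->
      P o \o F D @ \oo --> P o [set w | D (Z o w) /\ W c (U w)].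
    move=> mD; rewrite (_ : [set w | _] = \bigcup_n F D n); last first.
      rewrite /W WE; apply/seteqP; split => w.
        by move=> [Dw [n _ Uw]]; exists n.
      by move=> [n _ [Dw Uw]]; split => //; exists n.
    have mF n : measurable (F D n).
      have := mZ o measurableT _ mD; have := mU measurableT _ (mt n).
      by rewrite !setTI => ? ?; exact: measurableI.
    apply: nondecreasing_cvg_mu => //; first exact: bigcup_measurable.
    move=> m n mn; apply/subsetPset => w [Dw /=]; rewrite !in_itv/=.
    move=> /andP[_ Uw]; split => //=; rewrite in_itv/= U0 (le_trans Uw)//.
    exact: ndt.
  apply: (lee_cvg_to (Fcvg _ (mK c)) (Fcvg _ (mJ c))).
  apply: nearW => n; rewrite /= (law0 _ _ (mK c) (mt n) (@t_ge0 n)).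
  rewrite (law0 _ _ (mJ c) (mt n) (@t_ge0 n)).
  (* Since t n belongs to the window, phi (t n) < c, and the condition on phi at t n gives balance
     at c. *)
  have [tn0 tnc] := Wt n.
  exact: (balanced_interval mf f0 f1 (ltW tnc) (hphi_ineq _ tn0)).
have set_above theta c : c < b0 ->
    [set w | phi (U w) < c /\ c < b0 /\ c < Z theta w] =
    [set w | `]c, +oo[%classic (Z theta w) /\ W c (U w)].
  move=> cb; apply/seteqP; split => w /=; rewrite in_itv/= andbT.
    by move=> [Uc [_ cZ]]; split => //; split.
  by move=> [cZ [_ Uc]].
have set_below theta c : c < b0 ->
    [set w | phi (U w) < c /\ c < b0 /\ Z theta w <= c] =
    [set w | `]-oo, c]%classic (Z theta w) /\ W c (U w)].
  move=> cb; apply/seteqP; split => w /=; rewrite in_itv/=.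
    by move=> [Uc [_ cZ]]; split => //; split.
  by move=> [cZ [_ Uc]].
have weak theta c : c < b0 ->
    (P theta [set w | phi (U w) < c /\ c < b0 /\ c < Z theta w]%R <=
     P theta [set w | phi (U w) < c /\ c < b0 /\ Z theta w <= c]%R)%E.
  move=> cb; rewrite set_above// set_below//.
  rewrite (law _ _ _ (mK c) (mW c) (@W0 c)) (law _ _ _ (mJ c) (mW c) (@W0 c)).
  have [[t0 t00 Wt0]|nt0] := pselect (exists2 t0, 0 < t0 & W c t0).
    exact: (balance_weak mf f0 f1 hMLR (mW c) (Wdc c) (@W0 c) t00 Wt0
      (base _ _ cb t00 Wt0)).
  (* A window without positive elements is contained in the null set {0}, so the gap density
     vanishes. *)
  have w0 z : window f (W c) z = 0.
    rewrite -window_setD0// /window (_ : _ `\ _ = set0) ?integral_set0//.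
    rewrite -subset0 => u [Wu /eqP u0]; apply: nt0; exists u => //.
    by rewrite lt_neqAle eq_sym u0 (W0 _ _ Wu).
  rewrite integral0_eq.
    by apply: integral_ge0 => z _; rewrite lee_fin gap_density_ge0.
  by move=> z _; rewrite /gap_density !w0 !mulr0 addr0.
have mY : measurable_fun [set: T] (fun w => phi (U w)).
  rewrite (_ : (fun w => _) = (fun s => phi (Num.max 0 s)) \o U); last first.
    by apply/funext => w /=; rewrite max_r.
  by apply: measurableT_comp => //; exact: measurable_phi_ge0.
have Yb w : phi (U w) <= b0 by exact: phi_le.
have riskE theta :
    risk P X1 X2 (equivariant_estimator phi) theta =
    (\int[P theta]_w `|Z theta w - phi (U w)|%:E)%E.
  rewrite /risk unlock; apply: eq_integral => w _; congr (`|_|%:E).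
  by rewrite /equivariant_estimator /Z /U; ring.
have riskbE theta :
    risk P X1 X2 (equivariant_estimator (fun=> b0)) theta =
    (\int[P theta]_w `|Z theta w - b0|%:E)%E.
  rewrite /risk unlock; apply: eq_integral => w _; congr (`|_|%:E).
  by rewrite /equivariant_estimator /Z; ring.
split=> [theta|].
  move: (hfin_phi theta) (hfin_b0 theta); rewrite riskE riskbE => h1 h2.
  exact: (risk_le mY (mZ theta) Yb (weak _) h1 h2).
have [ts ts0 tsb] := hphi_nontrivial.
(* Every c between phi ts and b0 has ts in its window, which gives an interval of thresholds with
   strict inequality. *)
have {}tsb : phi ts < b0 by rewrite lt_neqAle tsb phi_le// ltW.
have [p [q [pq fp fq]]] := density_gt0_pair mf f0 f1.
(* The halves give 2 lam <= ts and lam < q - p, the smallness required by [balance_strict]. *)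
pose lam := Num.min (ts / 2) ((q - p) / 2).
have lam0 : 0 < lam by rewrite lt_min !divr_gt0// subr_gt0.
have lam_ts : 2 * lam <= ts.
  have : lam <= ts / 2 by rewrite ge_min lexx.
  lra.
have lam_pq : lam < q - p.
  have : lam <= (q - p) / 2 by rewrite ge_min lexx orbT.
  lra.
exists (lam, 0); move: (hfin_phi (lam, 0)) (hfin_b0 (lam, 0)).
rewrite riskE riskbE => h1 h2.
apply: (risk_lt mY (mZ _) Yb (weak _) h1 h2 tsb) => c /andP[pc cb].
have Wts : W c ts by split => //; exact: ltW.
rewrite set_above// set_below//.
rewrite (law _ _ _ (mK c) (mW c) (@W0 c)) (law _ _ _ (mJ c) (mW c) (@W0 c)).
rewrite /= subr0 gtr0_norm//.
exact: (balance_strict mf f0 f1 hMLR (mW c) (Wdc c) (@W0 c) ts0 Wts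
  (base _ _ cb ts0 Wts) lam0 lam_ts fp fq lam_pq).
Qed.
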